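(* Let $0<\xi<1$ and let $(z,z')$ belong to the principal, the complementary or the degenerate series. Under the correspondence $\lambda\mapsto \underline X(\lambda)$, the z-measure $M_{z,z',\xi}$ on $\mathbb Y$ determines (by push-forward) a determinantal probability measure on $\mathrm{Conf}(\mathbb Z')$; that is, there exists a function $K(x,y)$ on $\mathbb Z'\times\mathbb Z'$ such that for every $n=1,2,\dots$ and all pairwise distinct $x_1,\dots,x_n\in\mathbb Z'$, $$M_{z,z',\xi}\bigl(\{\lambda\in\mathbb Y:\ \{x_1,\dots,x_n\}\subset \underline X(\lambda)\}\bigr)=\det\left[K(x_i,x_j)\right]_{i,j=1}^n.$$
   Context: $\mathbb Y$ is the set of all partitions (identified with Young diagrams) $\lambda=(\lambda_1\ge\lambda_2\ge\dots)$, including the empty one; $|\lambda|$ is the number of boxes, $\ell(\lambda)$ the number of nonzero rows, $\dim\lambda$ the number of standard Young tableaux of shape $\lambda$. $(z)_\lambda=\prod_{i=1}^{\ell(\lambda)}(z-i+1)_{\lambda_i}$, where $(x)_k=x(x+1)\cdots(x+k-1)$. The z-measure is $$M_{z,z',\xi}(\lambda)=(1-\xi)^{zz'}\xi^{|\lambda|}(z)_\lambda(z')_\lambda\left(\frac{\dim\lambda}{|\lambda|!}\right)^2,\qquad \lambda\in\mathbb Y.$$ The pair $(z,z')$ is in the principal series if $z,z'$ are not real and are complex conjugate to each other; in the complementary series if $z,z'$ are both real and lie in the same open interval $(m,m+1)$ with $m\in\mathbb Z$; in the degenerate series if one of the numbers $z,z'$ (say, $z$) is a nonzero integer while the other one,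 $z'$, is real of the same sign and $|z'|>|z|-1$. In these cases, with $0<\xi<1$, $M_{z,z',\xi}$ is a probability measure. $\mathbb Z'=\mathbb Z+\frac12$ is the lattice of proper half-integers; $\mathrm{Conf}(\mathbb Z')$ is the set of all subsets of $\mathbb Z'$. For $\lambda\in\mathbb Y$, $\underline X(\lambda)=\{\lambda_i-i+\frac12\mid i=1,2,\dots\}\subset\mathbb Z'$ (the Maya diagram of $\lambda$). A probability measure on $\mathrm{Conf}(\mathbb Z')$ is determinantal if there is a function $K$ on $\mathbb Z'\times\mathbb Z'$ (a correlation kernel) such that its correlation functions $\rho_n(x_1,\dots,x_n)=\mathrm{Prob}\{\text{the random configuration contains }x_1,\dots,x_n\}$ ($x_i$ pairwise distinct) equal $\det[K(x_i,x_j)]_{i,j=1}^n$ for all $n=1,2,\dots$. *)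

(* Defs.v *)
From HB Require Import structures.
From mathcomp Require Import all_boot all_order all_algebra.
From mathcomp Require Import all_classical all_reals all_analysis.
From mathcomp Require Import complex.

Set Implicit Arguments.
Unset Strict Implicit.
Unset Printing Implicit Defensive.

Import Order.TTheory GRing.Theory Num.Theory.

Local Open Scope classical_set_scope.
Local Open Scope ring_scope.
Local Open Scope complex_scope.

(* A partition is the nonincreasing list of its nonzero parts. *)
Definition young : Type := {s : seq nat | sorted geq s && (0%N \notin s)}.

HB.instance Definition _ := Countable.on young.

Definition young_empty : young := exist _ [::] isT.

HB.instance Definition _ := isPointed.Build young young_empty.

HB.instance Definition _ := @isMeasurable.Build default_measure_display
  young discrete_measurable discrete_measurable0
  discrete_measurableC discrete_measurableU.

(* [part la i] is the part la_{i+1}: rows are numbered from 0, and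
   [part la i = 0] past the last row. *)
Definition part (la : young) (i : nat) : nat := nth 0%N (val la) i.

Definition ysize (la : young) : nat := sumn (val la).

Definition ylength (la : young) : nat := size (val la).

(* Boxes (row, column), both numbered from 0. *)
Definition box (la : young) : finType :=
  {i : 'I_(ylength la) & 'I_(part la i)}.

Definition brow (la : young) (b : box la) : nat := tag b.
Definition bcol (la : young) (b : box la) : nat := tagged b.

(* Tableau entries are numbered from 0 to |la| - 1. There are |la| boxes, so
   an injective filling uses every entry exactly once. *)
Definition standard_tableau (la : young)
    (T : {ffun box la -> 'I_(ysize la)}) : bool :=
  [&& injectiveb T,
      [forall b, forall c,
         ((brow b == brow c) && (bcol b < bcol c)%N) ==> (T b < T c)%N]
    & [forall b, forall c,
         ((bcol b == bcol c) && (brow b < brow c)%N) ==> (T b < T c)%N]].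

Definition ydim (la : young) : nat := #|[set T | @standard_tableau la T]%SET|.

Definition rising (R : realType) (x : R[i]) (k : nat) : R[i] :=
  \prod_(j < k) (x + j%:R).

(* With rows numbered from 0, the factor z - i + 1 becomes z - i. *)
Definition gen_rising (R : realType) (z : R[i]) (la : young) : R[i] :=
  \prod_(i < ylength la) rising (z - i%:R) (part la i).

(* a ^ w = exp (w ln a) for a > 0 and complex w. *)
Definition cpow (R : realType) (a : R) (w : R[i]) : R[i] :=
  (expR (complex.Re w * ln a))%:C *
  (cos (complex.Im w * ln a) +i* sin (complex.Im w * ln a)).

Definition zweight (R : realType) (z z' : R[i]) (xi : R) (la : young) : R[i] :=
  cpow (1 - xi) (z * z') * xi%:C ^+ ysize la *
  gen_rising z la * gen_rising z' la *
  ((ydim la)%:R / ((ysize la)`!)%:R) ^+ 2.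

Definition principal (R : realType) (z z' : R[i]) : Prop :=
  complex.Im z <> 0 /\ complex.Im z' <> 0 /\ z' = z^*.

Definition complementary (R : realType) (z z' : R[i]) : Prop :=
  exists (x x' : R) (m : int),
    [/\ z = x%:C, z' = x'%:C,
        m%:~R < x < (m + 1)%:~R & m%:~R < x' < (m + 1)%:~R].

Definition degenerate_at (R : realType) (z z' : R[i]) : Prop :=
  exists (m : int) (x' : R),
    [/\ z = (m%:~R)%:C, z' = x'%:C, m != 0,
        0 < m%:~R * x' & `|m%:~R| - 1 < `|x'|].

Definition degenerate (R : realType) (z z' : R[i]) : Prop :=
  degenerate_at z z' \/ degenerate_at z' z.

Definition halfint : Type := {x : rat | x - 2^-1 \is a Num.int}.

(* Configurations carry the product sigma-algebra, generated by the events
   "x belongs to the configuration". *)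
Definition cylinders : set (set (set halfint)) :=
  [set [set w : set halfint | w x] | x in [set: halfint]].

Notation conf := (g_sigma_algebraType cylinders).

Definition determinantal (R : realType) (P : probability conf R) : Prop :=
  exists K : halfint -> halfint -> R[i],
    forall (n : nat) (x : 'I_n -> halfint), (0 < n)%N -> injective x ->
      (fine (P [set w : conf | forall i, (w : set halfint) (x i)]))%:C =
      \det (\matrix_(i < n, j < n) K (x i) (x j)).

(* With rows numbered from 0, la_i - i + 1/2 becomes la_i - i - 1/2. *)
Definition maya (la : young) : conf :=
  [set x : halfint | exists i : nat, val x = (part la i)%:R - i%:R - 2^-1].

Lemma measurable_maya : measurable_fun [set: young] maya.
Proof. by []. Qed.

HB.instance Definition _ :=
  isMeasurableFun.Build _ _ young conf maya measurable_maya.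

(* Main.v *)
Require Import Defs.
From HB Require Import structures.
From mathcomp Require Import all_boot all_order all_algebra.
From mathcomp Require Import all_classical all_reals all_analysis.
From mathcomp Require Import complex.
From mathcomp Require Import fingroup perm.
From mathcomp Require Import zify ring lra.

(** Write [q c = (z + c) * (z' + c)]. In each of the three series [q] is a real
    quadratic polynomial with [q 0 >= 0], so the weight of a diagram is
    [(1 - xi) ^ (q 0)] times the product of [xi * q c] over the contents [c] of
    its boxes and of the squared ratio [dim / n!].

    On diagrams with at most [N] rows the weight is a squared determinant up to
    factors attached to single points. With
    shifted parts [l i], the ratio [dim / n!] is the determinant of the falling
    factorials [(l i) ^_ j] over the product of the [(l i)!] ([dim_ratioE]); it
    satisfies the same recursion on removable boxes as the number of standard
    tableaux. The content product factors over the [l i] as well. Hence on the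
    diagrams inside a rectangle, read as [N]-point configurations in a finite
    window, the weight is a constant times the squared maximal minor of one matrix
    [Phi] on the occupied rows ([box_weight_minor]). This needs a square root of
    the site weights, hence the positivity of [q] on the contents of the
    rectangle; in the degenerate series one side of the rectangle is fixed by the
    zero of [q], in the others both sides are free ([admissible]).

    The squared minors of a matrix define a determinantal process, whose kernel is
    the orthogonal projection on the column space ([sum_marked_minors]): by the
    Cauchy-Binet formula and Sylvester's identity, the generating function of the
    number of occupied marks is [\det (1 + ('X - 1) K)] up to a constant, and its
    top coefficient is the determinant of [K] on the marks. The window
    need not grow to cover every site, but sites outside it are surely occupied or surely
    empty for diagrams inside the rectangle, which adds rows of the identity or zero rows to
    the kernel.

    Summing the weights of all diagrams with [n] boxes, the recursions that add and
    remove a box ([ydim_rec], [sum_content_add_box]) give the coefficients of the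
    series of [(1 - xi) ^ (- q 0)] ([level_weight], [negbin_funE]), so the total
    mass is 1. Finally the rectangles grow. Entries of projection kernels lie
    in [[-1, 1]], so the kernels converge along an ultrafilter, while the
    correlations restricted to the rectangles converge to those of the whole
    measure ([det_kernel_limit], [quadratic_measure]). *)

Set Implicit Arguments.
Unset Strict Implicit.
Unset Printing Implicit Defensive.

Import Order.TTheory GRing.Theory Num.Theory.

Local Open Scope ring_scope.

(** * Determinants *)

Section Determinants.
Variable R : comNzRingType.

(** Both determinants are alternating in the choice of rows, so summing over all
    functions rather than over subsets of rows costs only the factor [N`!].
    This form of the Cauchy-Binet formula needs no enumeration of subsets. *)
Lemma sum_det_rowsub L N (A B : 'M[R]_(L, N)) :
  \sum_(f : {ffun 'I_N -> 'I_L}) \det (rowsub f A) * \det (rowsub f B) =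
  N`!%:R * \det (A^T *m B).
Proof.
under eq_bigr => f _ do rewrite {1}/determinant mulr_suml.
rewrite exchange_big /=.
transitivity (\sum_(s : 'S_N) \det (A^T *m B)); last first.
  by rewrite sumr_const card_Sn mulr_natl.
apply: eq_bigr => s _.
transitivity ((-1) ^+ s * \det (row_perm s (A^T *m B))); last first.
  by rewrite row_permE det_mulmx det_perm mulrA -signr_addb addbb mul1r.
under eq_bigr => f _ do rewrite -mulrA.
rewrite -mulr_sumr; congr (_ * _).
rewrite /determinant.
under eq_bigr => f _ do rewrite mulr_sumr.
rewrite exchange_big /=; apply: eq_bigr => t _.
under eq_bigr => f _ do rewrite mulrCA -big_split.
rewrite -mulr_sumr; congr (_ * _).
under [RHS]eq_bigr => i _ do rewrite !mxE.
rewrite bigA_distr_bigA /=; apply: eq_bigr => f _; apply: eq_bigr => i _.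
by rewrite !mxE.
Qed.

(** Sylvester's identity: eliminating either diagonal block of
    [block_mx 1%:M A (- B) 1%:M] leaves one of the two sides. *)
Lemma det_addmulmx m n (A : 'M[R]_(m, n)) (B : 'M[R]_(n, m)) :
  \det (1%:M + A *m B) = \det (1%:M + B *m A).
Proof.
have E1 : block_mx (1%:M + A *m B) A 0 1%:M *m block_mx 1%:M 0 (- B) 1%:M =
          block_mx 1%:M A (- B) 1%:M.
  by rewrite mulmx_block !mulmx1 !mul0mx !mulmx0 !mul1mx mulmxN addrK !add0r.
have E2 : block_mx 1%:M 0 (- B) 1%:M *m block_mx 1%:M A 0 (1%:M + B *m A) =
          block_mx 1%:M A (- B) 1%:M.
  rewrite mulmx_block !mulmx1 !mul0mx !mulmx0 !mul1mx mulNmx !addr0.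
  by rewrite addrCA addNr addr0.
have := congr1 determinant E1; rewrite -E2 !det_mulmx !det_ublock !det_lblock.
by rewrite !det1 !mul1r !mulr1.
Qed.

Lemma coef_det_linear n (A B : 'M[R]_n) :
  (\det (map_mx polyC B + 'X *: map_mx polyC A))`_n = \det A.
Proof.
have prodC (a b : 'I_n -> R) (r : seq 'I_n) :
    (\prod_(i <- r) ((b i)%:P + 'X * (a i)%:P))`_(size r) = \prod_(i <- r) a i
    /\ (size (\prod_(i <- r) ((b i)%:P + 'X * (a i)%:P))%R <= (size r).+1)%N.
  elim: r => [|i r [IH1 IH2]]; first by rewrite !big_nil coefC size_poly1.
  rewrite !big_cons; split.
    rewrite mulrDl coefD coefCM -mulrA coefXM /= coefCM IH1.
    by rewrite [X in b i * X]nth_default ?IH2// mulr0 add0r.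
  apply: (leq_trans (size_polyMleq _ _)).
  have : (size ((b i)%:P + 'X * (a i)%:P)%R <= 2)%N.
    apply: (leq_trans (size_polyD _ _)); rewrite geq_max.
    rewrite (leq_trans (size_polyC_leq1 _))//=.
    apply: (leq_trans (size_polyMleq _ _)); rewrite size_polyX.
    by rewrite ltnS size_polyC_leq1.
  move=> sz2; apply: (@leq_trans (2 + (size r).+1).-1); last by rewrite add2n.
  by rewrite -!subn1 leq_sub2r// leq_add.
rewrite /determinant coef_sum; apply: eq_bigr => s _.
have -> : ((-1) ^+ s : {poly R}) = ((-1) ^+ s)%:P.
  by rewrite rmorphXn /= rmorphN rmorph1.
rewrite coefCM; congr (_ * _).
under eq_bigr => i _ do rewrite !mxE.
have [+ _] := prodC (fun i => A i (s i)) (fun i => B i (s i)) (enum 'I_n).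
by rewrite size_enum_ord !big_enum.
Qed.

(** Replacing one row at a time by its image under the operator
    [A |-> diag_mx al *m A + A *m C] differentiates the determinant in that
    direction, and the logarithmic derivative is the trace of the operator. *)
Lemma sum_det_row_update N (A C : 'M[R]_N) (al : 'I_N -> R)
    (B : 'M[R]_N) :
  B = diag_mx (\row_i al i) *m A + A *m C ->
  \sum_i \det (\matrix_(k, j) (if k == i then B i j else A k j)) =
  (\sum_i al i + \tr C) * \det A.
Proof.
move=> defB; transitivity (\tr (B *m \adj A)).
  apply: eq_bigr => i _; rewrite (expand_det_row _ i) mxE; apply: eq_bigr => j _.
  rewrite mxE eqxx mxE; congr (_ * _); rewrite /cofactor; congr (_ * \det _).
  by apply/matrixP => a b; rewrite !mxE eq_sym (negPf (neq_lift _ _)).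
have trC : \tr (A *m C *m \adj A) = \tr C * \det A.
  rewrite -mulmxA mxtrace_mulC -mulmxA mul_adj_mx mul_mx_scalar mxtraceZ.
  exact: mulrC.
rewrite defB mulmxDl mxtraceD trC -mulmxA mul_mx_adj mul_mx_scalar mxtraceZ.
rewrite mulrDl; congr (_ + _); rewrite mulrC mxtrace_diag; congr (_ * _).
by apply: eq_bigr => i _; rewrite mxE.
Qed.

End Determinants.

(** * Finite determinantal projections *)

Section Projection.
Variable R : realFieldType.
Variables L N : nat.
Variable Phi : 'M[R]_(L, N).

Definition gram : 'M[R]_N := Phi^T *m Phi.

(** The orthogonal projection onto the column space of [Phi]. *)
Definition proj_kernel : 'M[R]_L := Phi *m invmx gram *m Phi^T.

Hypothesis gram_unit : gram \in unitmx.

Lemma proj_kernel_sym x y : proj_kernel x y = proj_kernel y x.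
Proof.
have symG : gram^T = gram by rewrite /gram trmx_mul trmxK.
have symK : proj_kernel^T = proj_kernel.
  by rewrite /proj_kernel !trmx_mul trmxK trmx_inv symG mulmxA.
by rewrite -[in LHS]symK mxE.
Qed.

Lemma proj_kernel_idem : proj_kernel *m proj_kernel = proj_kernel.
Proof.
rewrite /proj_kernel !mulmxA; congr (_ *m _).
by rewrite -!mulmxA (mulmxA Phi^T) -/gram mulmxV// mulmx1.
Qed.

(** The diagonal entry is the sum of the squares of its row, so it lies between
    0 and 1 and bounds every entry of that row. *)
Lemma proj_kernel_norm_le1 x y : `|proj_kernel x y| <= 1.
Proof.
have sq u v : proj_kernel u v ^+ 2 <= proj_kernel u u.
  have -> : proj_kernel u u = \sum_w proj_kernel u w * proj_kernel w u.
    by rewrite -[in LHS]proj_kernel_idem [LHS]mxE.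
  rewrite (bigD1 v)//=.
  rewrite [proj_kernel v u]proj_kernel_sym -expr2 lerDl sumr_ge0// => i _.
  by rewrite [proj_kernel i u]proj_kernel_sym -expr2 sqr_ge0.
have Kx_le1 : proj_kernel x x <= 1.
  rewrite leNgt; apply/negP => K1; have := sq x x.
  by rewrite leNgt expr2 ltr_pMr ?K1// (lt_trans ltr01).
have : proj_kernel x y ^+ 2 <= 1 by exact: le_trans (sq x y) Kx_le1.
by rewrite -real_normK ?num_real// expr_le1// normr_ge0.
Qed.

Section Marked.
Variable n : nat.

(** A marked point is either a position of the window, or lies outside of it:
    [inr true] stands for a position that is always occupied, and [inr false]
    for one that never is. *)
Variable pos : 'I_n -> 'I_L + bool.
Hypothesis pos_inj : forall i j u, pos i = inl u -> pos j = inl u -> i = j.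

Definition marks_hit (f : 'I_N -> 'I_L) : bool :=
  [forall i, match pos i with inl u => [exists k, f k == u] | inr b => b end].

Definition marked_kernel : 'M[R]_n :=
  \matrix_(i, j) match pos i, pos j with
                 | inl u, inl v => proj_kernel u v
                 | inr b, _ => (b && (i == j))%:R
                 | inl _, inr _ => 0
                 end.

Let full (i : 'I_n) : bool := if pos i is inr true then true else false.
Let sel : 'M[R]_(n, L) := \matrix_(i, u) (pos i == inl u)%:R.
Let marked (u : 'I_L) : bool := [exists i, pos i == inl u].

Let hits (f : 'I_N -> 'I_L) : nat := #|[pred k | marked (f k)]|.

Let card_full_hits f : injective f -> (#|full| + hits f <= n)%N /\
  ((#|full| + hits f == n)%N = marks_hit f).
Proof.
move=> injf.
pose B : {set 'I_n} := [set i | if pos i is inl u then [exists k, f k == u] else false].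
have -> : hits f = #|B|.
  have injfB : {in [pred k | marked (f k)] &, injective f} by move=> ? ? _ _ /injf.
  rewrite /hits -(card_in_imset injfB).
  pose g (i : 'I_n) : option 'I_L := if pos i is inl u then Some u else None.
  have injg : {in B &, injective g}.
    move=> i j; rewrite !inE /g; case Ei: (pos i) => [u|]//; case Ej: (pos j) => [v|]//.
    by move=> _ _ [uv]; apply: (pos_inj Ei); rewrite Ej uv.
  rewrite -(card_in_imset injg) -(card_imset (f @: _) (@Some_inj _)); apply: eq_card => o.
  apply/imsetP/imsetP => -[].
    move=> u /imsetP[k]; rewrite inE => /existsP[i /eqP Ei] -> ->.
    by exists i; rewrite ?inE /g Ei//; apply/existsP; exists k.
  move=> i; rewrite inE /g; case Ei: (pos i) => [u|]// /existsP[k /eqP fk] ->.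
  by exists u => //; apply/imsetP; exists k => //; rewrite inE; apply/existsP; exists i; rewrite fk Ei.
have -> : #|full| = #|[set i | full i]| by rewrite cardsE.
have dis : [disjoint [set i | full i] & B].
  rewrite -setI_eq0; apply/eqP/setP => i; rewrite !inE /full.
  by case: (pos i) => [u|[]]//=; rewrite andbF.
rewrite -cardsUI; move: dis; rewrite -setI_eq0 => /eqP ->; rewrite cards0 addn0.
split; first by rewrite -[leqRHS]card_ord max_card.
set C := _ :|: B; have -> : marks_hit f = (C == [set: 'I_n]).
  apply/forallP/eqP => [hit|CT i].
    apply/setP => i; rewrite !inE /full; have := hit i.
    by case: (pos i) => [u|[]].
  have := finset.in_setT i; rewrite -CT !inE /full.
  by case: (pos i) => [u|[]].
by rewrite eqEcard finset.subsetT cardsT card_ord eqn_leq -[X in (_ <= X)%N]card_ord max_card.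
Qed.

(** With weight ['X] on the marked positions of the window, the sum over the
    configurations becomes [\det (1 + ('X - 1) K)]; the configurations that
    meet every mark are those of top degree. The marks that are always hit
    contribute the factor ['X ^+ #|full|], that is, the rows ['X] times a unit
    vector. *)
Lemma sum_marked_minors :
  \sum_(f : {ffun 'I_N -> 'I_L} | marks_hit f) \det (rowsub f Phi) ^+ 2 =
  N`!%:R * \det gram * \det marked_kernel.
Proof.
pose d (u : 'I_L) : {poly R} := if marked u then 'X else 1.
pose P := map_mx polyC Phi.
pose DP : 'M[{poly R}]_(L, N) := diag_mx (\row_u d u) *m P.
pose S := \sum_(f : {ffun 'I_N -> 'I_L}) \det (rowsub f DP) * \det (rowsub f P).
have minorE f : \det (rowsub f DP) * \det (rowsub f P) =
    'X ^+ hits f * (\det (rowsub f Phi) ^+ 2)%:P.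
  have -> : rowsub f P = map_mx polyC (rowsub f Phi).
    by apply/matrixP => i j; rewrite !mxE.
  have -> : rowsub f DP =
      diag_mx (\row_i d (f i)) *m map_mx polyC (rowsub f Phi).
    by apply/matrixP => i j; rewrite /DP !mul_diag_mx !mxE.
  rewrite det_mulmx det_diag -mulrA det_map_mx -rmorphM -expr2; congr (_ * _).
  under eq_bigr => i _ do rewrite mxE /d.
  by rewrite -big_mkcond /= prodr_const.
have lhsE : ('X ^+ #|full| * S)`_n =
    \sum_(f : {ffun 'I_N -> 'I_L} | marks_hit f) \det (rowsub f Phi) ^+ 2.
  rewrite /S mulr_sumr coef_sum [RHS]big_mkcond /=; apply: eq_bigr => f _.
  rewrite minorE mulrA -exprD mulrC coefCM coefXn.
  have [injf|ninjf] := boolP (injectiveb f).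
    have [_ <-] := card_full_hits (injectiveP _ injf).
    by rewrite eq_sym; case: eqP; rewrite ?mulr1 ?mulr0.
  have /injectivePn[i [j ij fij]] := ninjf.
  have -> : \det (rowsub f Phi) = 0.
    by apply: (determinant_alternate ij) => k; rewrite !mxE fij.
  by rewrite expr0n mul0r if_same.
rewrite -lhsE /S sum_det_rowsub.
pose E := map_mx polyC sel.
(* distinct marks are distinct positions, so [E^T *m E] projects on the marks *)
have DE : diag_mx (\row_u d u) = 1%:M + ('X - 1) *: (E^T *m E).
  apply/matrixP => u v; rewrite !mxE.
  under eq_bigr => i _ do rewrite !mxE -rmorphM -natrM mulnb.
  have [<-|uv] := eqVneq u v; rewrite ?mulr1n ?mulr0n; last first.
    rewrite big1 ?mulr0 ?addr0// => i _; case: eqP => //= ->.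
    by case: eqP => // -[/eqP]; rewrite (negPf uv).
  under eq_bigr => i _ do rewrite andbb.
  rewrite /d /marked; case: existsP => [[i /eqP Ei]|nex].
    rewrite (bigD1 i)//= Ei eqxx big1 ?addr0 => [|j /eqP ji].
      by rewrite mulr1 addrC subrK.
    by case: eqP => // Ej; case: ji; apply: pos_inj Ej Ei.
  rewrite big1 ?mulr0 ?addr0// => i _; case: eqP => // Ei.
  by case: nex; exists i; rewrite Ei.
pose G := map_mx polyC gram; pose iG := map_mx polyC (invmx gram).
have GiG : G *m iG = 1%:M by rewrite -map_mxM mulmxV// map_mx1.
have PP : P^T *m P = G by rewrite /P map_trmx -map_mxM.
have detE : \det (DP^T *m P) =
    (\det gram)%:P * \det (1%:M + ('X - 1) *: map_mx polyC (sel *m proj_kernel *m sel^T)).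
  rewrite /DP trmx_mul tr_diag_mx DE mulmxDr mulmx1 mulmxDl PP.
  transitivity (\det (G *m (1%:M + (iG *m P^T *m E^T) *m (('X - 1) *: (E *m P))))).
    congr (\det _); rewrite mulmxDr mulmx1 !mulmxA GiG mul1mx.
    by rewrite -!scalemxAr -!scalemxAl !mulmxA.
  rewrite det_mulmx det_addmulmx -[G]/(map_mx _ _) det_map_mx; congr (_ * \det (_ + _)).
  rewrite -scalemxAl; congr (_ *: _).
  by rewrite /proj_kernel !map_mxM -!map_trmx !mulmxA.
rewrite detE.
pose Kr := sel *m proj_kernel *m sel^T.
have rowE : 'X ^+ #|full| * \det (1%:M + ('X - 1) *: map_mx polyC Kr) =
    \det (map_mx polyC (1%:M - marked_kernel) + 'X *: map_mx polyC marked_kernel).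
  transitivity (\det (diag_mx (\row_i (if full i then 'X else 1)) *m
       (1%:M + ('X - 1) *: map_mx polyC Kr))).
    rewrite det_mulmx det_diag; congr (_ * _).
    under [RHS]eq_bigr => i _ do rewrite mxE.
    by rewrite -big_mkcond /= prodr_const.
  congr (\det _); apply/matrixP => i j; rewrite mul_diag_mx !mxE.
  have -> : (\sum_j0 (sel *m proj_kernel) i j0 * sel^T j0 j) =
      match pos i, pos j with inl u, inl v => proj_kernel u v | _, _ => 0 end.
    case Ej: (pos j) => [v|b]; last first.
      by rewrite big1 => [|k _]; rewrite ?mxE ?Ej ?mulr0//; case: (pos i).
    rewrite (bigD1 v)//= [sel^T _ _]mxE [sel _ _]mxE Ej eqxx mulr1 mxE.
    rewrite [X in _ + X]big1 ?addr0; last first.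
      move=> k kv; rewrite [sel^T _ _]mxE [sel _ _]mxE Ej.
      by rewrite (inj_eq inl_inj) eq_sym (negPf kv) mulr0.
    case Ei: (pos i) => [u|b]; last first.
      by rewrite big1 => // k _; rewrite mxE Ei mul0r.
    rewrite (bigD1 u)//= !mxE Ei eqxx mul1r [X in _ + X]big1 ?addr0// => k ku.
    by rewrite !mxE Ei (inj_eq inl_inj) eq_sym (negPf ku) mul0r.
  rewrite /full; case Ei: (pos i) => [u|[]]/=; rewrite ?mul1r.
  - case Ej: (pos j) => [v|b]; last by rewrite polyC0 !mulr0 !addr0 subr0; case: eqP.
    by rewrite polyCB; case: eqP => _; ring.
  - by rewrite subrr polyC0 mulr0 addr0 add0r; case: eqP.
  - by rewrite polyC0 !mulr0 !addr0 subr0; case: eqP.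
have reorder (a b c e : {poly R}) : a * (b * (c * e)) = b * (c * (a * e)) by ring.
rewrite reorder rowE -polyC_natr -mulrA.
by rewrite !coefCM coef_det_linear.
Qed.

End Marked.
End Projection.

(** * Counting linear extensions *)

Definition linear_ext (B : finType) (lt : rel B) n (T : {ffun B -> 'I_n}) : bool :=
  injectiveb T && [forall b, forall c, lt b c ==> (T b < T c)%N].

Lemma linear_extP (B : finType) (lt : rel B) n (T : {ffun B -> 'I_n}) :
  reflect (injective T /\ forall b c, lt b c -> (T b < T c)%N) (linear_ext lt T).
Proof.
apply: (iffP andP) => -[/injectiveP injT ltT]; split=> //.
  by move=> b c bc; move/forallP: ltT => /(_ b)/forallP/(_ c)/implyP; apply.
by apply/forallP => b; apply/forallP => c; apply/implyP/ltT.
Qed.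

(** Erasing the largest entry of a linear extension leaves a linear extension of
    the poset without the corresponding element [b0]. *)
Lemma card_linear_ext_max (B B' : finType) (lt : rel B) (h : B' -> B) (b0 : B) n :
  injective h -> (forall b, (b \in codom h) = (b != b0)) ->
  (forall c, ~~ lt b0 c) ->
  #|[set T : {ffun B -> 'I_n.+1} | linear_ext lt T && (T b0 == ord_max)]%SET| =
  #|[set T : {ffun B' -> 'I_n} | linear_ext (fun b c => lt (h b) (h c)) T]%SET|.
Proof.
move=> injh codh maxb0.
pose ext (T : {ffun B' -> 'I_n}) : {ffun B -> 'I_n.+1} :=
  [ffun b => if [pick b' | h b' == b] is Some b' then widen_ord (leqnSn n) (T b')
             else ord_max].
have ext_h T b' : ext T (h b') = widen_ord (leqnSn n) (T b').
  rewrite ffunE; case: pickP => [c /eqP/injh ->//|/(_ b')].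
  by rewrite eqxx.
have ext_b0 T : ext T b0 = ord_max.
  rewrite ffunE; case: pickP => [c /eqP hc|//].
  by have := codom_f h c; rewrite hc codh eqxx.
have hP b : b = b0 \/ exists b', b = h b'.
  have [->|bb0] := eqVneq b b0; first by left.
  by right; apply/codomP; rewrite codh.
have inj_ext : injective ext.
  move=> T T' eqT; apply/ffunP => b'; have := ext_h T b'.
  by rewrite eqT ext_h => /(congr1 val)/= /val_inj.
rewrite -(card_imset _ inj_ext); apply: eq_card => T.
rewrite inE; apply/andP/imsetP => [[/linear_extP[injT ltT] /eqP Tb0]|[T']].
  have Tlt b' : (T (h b') < n)%N.
    rewrite ltn_neqAle -ltnS ltn_ord andbT.
    apply/negP => /eqP Tn; have /injT hb0 : T (h b') = T b0.
      by apply: val_inj; rewrite Tb0.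
    by have := codom_f h b'; rewrite hb0 codh eqxx.
  exists [ffun b' => Ordinal (Tlt b')].
    rewrite inE; apply/linear_extP; split.
      move=> b c; rewrite !ffunE => /(congr1 val)/= Tbc.
      by apply: injh; apply: injT; apply: val_inj.
    by move=> b c bc; rewrite !ffunE /=; apply: ltT.
  apply/ffunP => b; apply: val_inj; have [->|[b' ->]] := hP b.
    by rewrite ext_b0 Tb0.
  by rewrite ext_h ffunE.
rewrite inE => /linear_extP[injT ltT] ->; rewrite ext_b0 eqxx; split=> //.
apply/linear_extP; split=> [b c|b c].
  have [->|[b' ->]] := hP b; have [->|[c' ->]] := hP c => //.
  - rewrite ext_b0 ext_h => /(congr1 val)/= nT.
    by have := ltn_ord (T' c'); rewrite -nT ltnn.
  - rewrite ext_b0 ext_h => /(congr1 val)/= nT.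
    by have := ltn_ord (T' b'); rewrite nT ltnn.
  - by rewrite !ext_h => /(congr1 val)/= /val_inj/injT ->.
have [->|[b' ->]] := hP b; first by rewrite (negPf (maxb0 c)).
have [->|[c' ->]] := hP c; first by rewrite ext_b0 ext_h /=.
by rewrite !ext_h /=; apply: ltT.
Qed.

(** The largest entry is attained, since there are as many entries as elements,
    and nothing lies above the element that carries it. *)
Lemma card_linear_ext_rec (B : finType) (lt : rel B) n : #|B| = n.+1 ->
  #|[set T : {ffun B -> 'I_n.+1} | linear_ext lt T]%SET| =
  (\sum_(b0 | [forall c, ~~ lt b0 c])
    #|[set T : {ffun B -> 'I_n.+1} | linear_ext lt T && (T b0 == ord_max)]%SET|)%N.
Proof.
move=> cB.
have bij (T : {ffun B -> 'I_n.+1}) : injective T -> exists b, T b = ord_max.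
  move=> injT; have /(inj_card_onto injT) : (#|'I_n.+1| <= #|B|)%N by rewrite cB card_ord.
  by move=> /(_ ord_max)/codomP[b ->]; exists b.
rewrite -sum1_card (eq_bigr (fun T : {ffun B -> 'I_n.+1} =>
    \sum_(b0 | [forall c, ~~ lt b0 c]) (T b0 == ord_max))%N); last first.
  move=> T; rewrite inE => /linear_extP[injT ltT]; have [b Tb] := bij _ injT.
  rewrite (bigD1 b) ?Tb ?eqxx/=.
    rewrite big1 // => c /andP[_ cb]; apply/eqP; rewrite eqb0; apply: contra cb => /eqP Tc.
    by apply/eqP/injT; rewrite Tc Tb.
  by apply/forallP => c; apply/negP => /ltT; rewrite Tb ltnNge -ltnS ltn_ord.
rewrite exchange_big /=; apply: eq_bigr => b _.
rewrite -sum1_card big_mkcond [RHS]big_mkcond /=; apply: eq_bigr => T _.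
by rewrite !inE; case: linear_ext => //=; case: eqP.
Qed.

(** * Young diagrams row by row *)

(** The parts are [f 0, f 1, ...] when [f] is nonincreasing and vanishes from [N]
    on, see [part_young_of]; the value is a default otherwise. *)
Definition young_of (f : nat -> nat) (N : nat) : young :=
  insubd young_empty [seq x <- mkseq f N | x != 0%N].

Lemma part_noninc (la : young) i j : (i <= j)%N -> (part la j <= part la i)%N.
Proof.
move=> ij; rewrite /part; case/andP: (valP la) => sla _.
have [jla|laj] := ltnP j (size (val la)); last by rewrite (nth_default _ laj).
have geq_trans : transitive geq by move=> a b c /= ab bc; exact: leq_trans bc ab.
have := sorted_leq_nth geq_trans (fun x => leqnn x) 0%N sla.
by apply=> //; rewrite inE ?(leq_ltn_trans ij).
Qed.

Lemma part_eq0 (la : young) i : (part la i == 0)%N = (ylength la <= i)%N.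
Proof.
rewrite /part /ylength leqNgt; have [ila|] := ltnP i (size (val la)); last first.
  by move=> ?; rewrite nth_default ?eqxx.
apply/negbTE; apply/negP => /eqP la0; case/andP: (valP la) => _.
by have := mem_nth 0%N ila; rewrite la0 => ->.
Qed.

Lemma part_inj (la mu : young) : (forall i, part la i = part mu i) -> la = mu.
Proof.
move=> eq_part; apply: val_inj.
have eq_size : ylength la = ylength mu.
  apply/eqP; rewrite eqn_leq -!part_eq0 eq_part part_eq0 leqnn.
  by rewrite -eq_part part_eq0 leqnn.
by apply: (@eq_from_nth _ 0%N); [exact: eq_size | move=> i _; exact: eq_part].
Qed.

Lemma part_young_of f N i : (forall j, f j.+1 <= f j)%N -> f N = 0%N ->
  part (young_of f N) i = f i.
Proof.
move=> fS fN0.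
have fmono j k : (j <= k)%N -> (f k <= f j)%N.
  elim: k => [|k IH]; first by rewrite leqn0 => /eqP ->.
  by rewrite leq_eqVlt ltnS => /predU1P[->//|/IH]; exact: leq_trans.
(* [m] is the number of positive values *)
have [m [mN fm0 fpos]] : exists m, [/\ (m <= N)%N, f m = 0%N &
    forall j, (j < m)%N -> (0 < f j)%N].
  have ex0 : exists j, f j == 0%N by exists N; rewrite fN0.
  exists (ex_minn ex0); case: ex_minnP => m /eqP fm minm; split=> //.
    by apply: minm; rewrite fN0.
  by move=> j jm; rewrite lt0n; apply/negP => /minm; rewrite leqNgt jm.
have filE : [seq x <- mkseq f N | x != 0%N] = mkseq f m.
  rewrite -(subnKC mN) /mkseq iotaD map_cat filter_cat add0n.
  rewrite (@eq_in_filter _ _ xpredT) ?filter_predT; last first.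
    by move=> x /mapP[j]; rewrite mem_iota => /andP[_ jm] ->; rewrite -lt0n fpos.
  rewrite (@eq_in_filter _ _ pred0) ?filter_pred0 ?cats0// => x /mapP[j].
  rewrite mem_iota => /andP[mj _] ->; apply/negbTE; rewrite negbK -leqn0 -fm0.
  exact: fmono.
have wf : sorted geq (mkseq f m) && (0%N \notin mkseq f m).
  apply/andP; split.
    apply/(sortedP 0%N) => j; rewrite size_mkseq => jm.
    by rewrite !nth_mkseq// ?(ltnW jm)//=; exact: fS.
  by apply/mapP => -[j]; rewrite mem_iota => /andP[_ /fpos jm] j0; rewrite -j0 in jm.
rewrite /part /young_of filE /insubd insubT /=.
have [im|mi] := ltnP i m; first by rewrite nth_mkseq.
rewrite nth_default ?size_mkseq//; apply/esym/eqP.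
by rewrite -leqn0 -fm0; exact: fmono.
Qed.

Lemma ysizeE (la : young) N : (ylength la <= N)%N ->
  ysize la = (\sum_(i < N) part la i)%N.
Proof.
move=> laN; rewrite /ysize sumnE (big_nth 0%N) big_mkord -/(ylength la).
rewrite -(subnKC laN) big_split_ord /= [X in (_ + X)%N]big1 ?addn0// => i _.
by apply/eqP; rewrite part_eq0 leq_addr.
Qed.

Definition addable (la : young) i := (i == 0)%N || (part la i < part la i.-1)%N.
Definition removable (la : young) i := (part la i.+1 < part la i)%N.

Definition add_box (la : young) i : young :=
  young_of (fun k => part la k + (k == i))%N (maxn (ylength la) i.+1).
Definition rem_box (la : young) i : young :=
  young_of (fun k => part la k - (k == i))%N (ylength la).

Lemma part_add_box (la : young) i k : addable la i ->
  part (add_box la i) k = (part la k + (k == i))%N.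
Proof.
move=> ai; apply: part_young_of => [j|].
  have := part_noninc la (leqnSn j); move: ai; rewrite /addable.
  by case: (eqVneq j.+1 i) => [<-/=|]; lia.
have [E1 E2] : part la (maxn (ylength la) i.+1) = 0%N /\
    (maxn (ylength la) i.+1 == i) = false.
  split; first by apply/eqP; rewrite part_eq0 leq_maxl.
  by apply/negbTE; rewrite neq_ltn; apply/orP; right; exact: leq_maxr.
by rewrite E1 E2.
Qed.

Lemma part_rem_box (la : young) i k : removable la i ->
  part (rem_box la i) k = (part la k - (k == i))%N.
Proof.
move=> ri; apply: part_young_of => [j|].
  have := part_noninc la (leqnSn j); move: ri; rewrite /removable.
  by case: (eqVneq j i) => [<-/=|]; lia.
by have /eqP -> : part la (ylength la) == 0%N by rewrite part_eq0.
Qed.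

(** Adding and removing boxes are adjoint, which lets sums over pairs of adjacent
    diagrams be organized by either member. *)
Lemma add_box_rem_box (la mu : young) i :
  removable mu i && (la == rem_box mu i) = addable la i && (mu == add_box la i).
Proof.
apply/andP/andP => -[h /eqP ->].
  have ai : addable (rem_box mu i) i.
    rewrite /addable !part_rem_box//; move: h; rewrite /removable.
    have := part_noninc mu (leq_pred i); have := part_noninc mu (leqnSn i).
    by case: i => [|i]//=; lia.
  split=> //; apply/eqP/part_inj => k; rewrite part_add_box// part_rem_box//.
  by move: h; rewrite /removable; case: (eqVneq k i) => [->|] /=; lia.
have ri : removable (add_box la i) i.
  rewrite /removable !part_add_box//; have := part_noninc la (leqnSn i).
  by lia.
split=> //; apply/eqP/part_inj => k; rewrite part_rem_box// part_add_box//.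
by lia.
Qed.

Lemma addable_leq_ylength (la : young) i : addable la i -> (i <= ylength la)%N.
Proof.
case: i => [//|i]; rewrite /addable /= => h; rewrite ltnNge -part_eq0.
by rewrite -lt0n; apply: leq_ltn_trans h.
Qed.

Lemma ysize_add_box (la : young) i : addable la i ->
  ysize (add_box la i) = (ysize la).+1.
Proof.
move=> ai; set N := maxn (ylength la).+1 (ylength (add_box la i)).
rewrite (@ysizeE _ N) ?leq_maxr// (@ysizeE la N); last first.
  by rewrite ltnW// leq_maxl.
have iN : (i < N)%N by rewrite (leq_trans _ (leq_maxl _ _))// ltnS addable_leq_ylength.
under eq_bigr => k _ do rewrite part_add_box//.
rewrite big_split /= -addn1; congr addn.
by rewrite (bigD1 (Ordinal iN))//= eqxx big1// => k; rewrite -val_eqE /= => /negPf ->.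
Qed.

Lemma ysize_rem_box (la : young) i : removable la i ->
  ysize la = (ysize (rem_box la i)).+1.
Proof.
move=> ri; have := add_box_rem_box (rem_box la i) la i.
rewrite ri eqxx => /esym/andP[ai /eqP E].
by rewrite [in LHS]E ysize_add_box.
Qed.

Lemma exists_removable (la : young) : (0 < ysize la)%N -> exists i, removable la i.
Proof.
move=> la0; have l0 : (0 < ylength la)%N.
  rewrite lt0n; apply: contraTN la0 => /eqP l0.
  by rewrite (@ysizeE _ 0) ?l0// big_ord0.
exists (ylength la).-1; rewrite /removable prednK//.
have /eqP -> : part la (ylength la) == 0%N by rewrite part_eq0.
by rewrite lt0n part_eq0 -ltnNge prednK.
Qed.

(** ** Standard tableaux *)

Definition lt_box (la : young) : rel (box la) := fun b c =>
  (brow b == brow c) && (bcol b < bcol c)%N ||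
  (bcol b == bcol c) && (brow b < brow c)%N.

Lemma ydimE (la : young) n : ysize la = n ->
  ydim la = #|[set T : {ffun box la -> 'I_n} | linear_ext (@lt_box la) T]%SET|.
Proof.
move=> <-; apply: eq_card => T; rewrite !inE /standard_tableau /linear_ext.
congr (_ && _); apply/andP/forallP => [[/forallP h1 /forallP h2] b|h].
  apply/forallP => c; apply/implyP => /orP[bc|bc].
    by move/forallP: (h1 b) => /(_ c)/implyP; apply.
  by move/forallP: (h2 b) => /(_ c)/implyP; apply.
by split; apply/forallP => b; apply/forallP => c; apply/implyP => bc;
  move/forallP: (h b) => /(_ c)/implyP; apply; rewrite /lt_box bc ?orbT.
Qed.

Lemma card_box (la : young) : #|{: box la}| = ysize la.
Proof.
rewrite card_tagged (ysizeE (leqnn _)) sumnE big_map big_enum /=.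
by apply: eq_bigr => i _; rewrite card_ord.
Qed.

Lemma bcol_lt (la : young) (b : box la) : (bcol b < part la (brow b))%N.
Proof. exact: ltn_ord. Qed.

Lemma box_inj (la : young) (b c : box la) : brow b = brow c -> bcol b = bcol c -> b = c.
Proof.
case: b c => i j [i' j']; rewrite /brow /bcol /= => /val_inj ii'.
by case: _ / ii' j' => j' /val_inj ->.
Qed.

Lemma box_exists (la : young) i j : (j < part la i)%N ->
  exists b : box la, brow b = i /\ bcol b = j.
Proof.
move=> ji; have il : (i < ylength la)%N.
  by rewrite ltnNge -part_eq0 -lt0n (leq_ltn_trans _ ji).
by exists (Tagged (fun i : 'I_(ylength la) => 'I_(part la i)) (Ordinal ji : 'I_(part la (Ordinal il)))).
Qed.

(** The largest entry of a standard tableau sits in a removable box. *)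
Lemma ydim_rec (la : young) N : (0 < ysize la)%N -> (ylength la <= N)%N ->
  ydim la = (\sum_(i < N | removable la i) ydim (rem_box la i))%N.
Proof.
move=> la0 laN; set n := (ysize la).-1; have sn : ysize la = n.+1 by rewrite prednK.
rewrite (ydimE sn) card_linear_ext_rec ?card_box//.
have corner (i : 'I_N) : removable la i ->
    exists b : box la, brow b = i /\ bcol b = (part la i).-1.
  by move=> ri; apply: box_exists; move: ri; rewrite /removable; lia.
pose b_of (i : 'I_N) : option (box la) :=
  [pick b : box la | (brow b == i) && (bcol b == (part la i).-1)].
have b_ofP (i : 'I_N) : removable la i ->
    exists2 b, b_of i = Some b & brow b = i /\ bcol b = (part la i).-1.
  move=> /corner[b [b1 b2]]; rewrite /b_of; case: pickP => [c /andP[/eqP c1 /eqP c2]|/(_ b)].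
    by exists c.
  by rewrite b1 b2 !eqxx.
have row_lt (b : box la) : (brow b < N)%N by apply: leq_trans laN; exact: ltn_ord.
(* a box is maximal exactly when it ends both its row and its column *)
have maxE (b : box la) : [forall c, ~~ lt_box b c] =
    removable la (brow b) && (bcol b == (part la (brow b)).-1).
  apply/forallP/andP => [h|[ri /eqP bc] c].
    have h1 : (part la (brow b) <= (bcol b).+1)%N.
      rewrite leqNgt; apply/negP => /box_exists[c [c1 c2]].
      by have := h c; rewrite /lt_box c1 c2 eqxx ltnSn.
    have h2 : (part la (brow b).+1 <= bcol b)%N.
      rewrite leqNgt; apply/negP => /box_exists[c [c1 c2]].
      by have := h c; rewrite /lt_box c1 c2 eqxx ltnSn orbT.
    by have := bcol_lt b; rewrite /removable; split; [lia|apply/eqP; lia].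
  have := bcol_lt b; have := bcol_lt c; rewrite /lt_box bc.
  move: ri; rewrite /removable => ri hc hb; apply/negP => /orP[/andP[/eqP e]|/andP[/eqP e rr]].
    by rewrite e in hb *; lia.
  have := part_noninc la rr; lia.
rewrite (eq_bigl _ _ maxE).
rewrite (partition_big (fun b => Ordinal (row_lt b)) (fun i : 'I_N => removable la i)); last first.
  by move=> b /andP[].
apply: eq_bigr => i ri; have [b _ [b1 b2]] := b_ofP i ri.
rewrite (big_pred1 b) => [|c]; last first.
  rewrite -val_eqE /=; apply/andP/eqP => [[/andP[_ /eqP c2] /eqP c1]|->].
    by apply: box_inj; rewrite ?b1// c2 c1 b2.
  by rewrite b1 b2 ri !eqxx.
have sr : ysize (rem_box la i) = n by apply/eqP; rewrite -eqSS -ysize_rem_box// sn.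
have lift_ex (c : box (rem_box la i)) : {d : box la | (brow d == brow c) && (bcol d == bcol c)}.
  apply: sigW; have : (bcol c < part la (brow c))%N.
    by have := bcol_lt c; rewrite part_rem_box//; lia.
  by move=> /box_exists[d [d1 d2]]; exists d; rewrite d1 d2 !eqxx.
pose h c := sval (lift_ex c).
have hr c : brow (h c) = brow c by rewrite /h; case: (lift_ex c) => d /= /andP[/eqP].
have hc c : bcol (h c) = bcol c by rewrite /h; case: (lift_ex c) => d /= /andP[_ /eqP].
rewrite (ydimE sr) (@card_linear_ext_max _ _ _ h).
- by apply: eq_card => T; rewrite !inE; congr (_ && _); apply: eq_forallb => c;
    apply: eq_forallb => d; rewrite /lt_box !hr !hc.
- by move=> c d cd; apply: box_inj; rewrite -?hr -?hc cd.
- move=> c; apply/codomP/negP => [[d ->] /eqP hb|cb].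
    by have := bcol_lt d; rewrite part_rem_box// -hr -hc hb b1 b2 eqxx; lia.
  have : (bcol c < part (rem_box la i) (brow c))%N.
    have := bcol_lt c; rewrite part_rem_box//; case: eqVneq => [ci|_]; last by rewrite subn0.
    have : bcol c <> (part la i).-1 by move=> e; apply: cb; apply/eqP/box_inj; rewrite ?b1 ?b2.
    by rewrite ci /=; lia.
  by move=> /box_exists[d [d1 d2]]; exists d; apply: box_inj; rewrite ?hr ?hc ?d1 ?d2.
- by apply/forallP; rewrite maxE b1 b2 ri eqxx.
Qed.

Lemma ydim_size0 (la : young) : ysize la = 0%N -> ydim la = 1%N.
Proof.
move=> sla; have b0 : #|{: box la}| = 0%N by rewrite card_box.
rewrite (ydimE sla) (@eq_card _ _ (mem [set: {ffun box la -> 'I_0}]%SET)).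
  by rewrite cardsT card_ffun card_ord b0.
by move=> T; rewrite !inE; apply/linear_extP; split=> b; have := card0_eq b0 b.
Qed.

(** * The determinantal formula for the dimension *)

Section Dimension.
Variable R : realFieldType.

(** Numbering the rows from the bottom makes the shifted parts increase with [i],
    and the matrix of falling factorials of the empty diagram triangular; no sign
    appears in [dim_ratioE]. *)
Definition shifted (la : young) N (i : nat) : nat := (part la (N.-1 - i)%N + i)%N.

Definition ffact_mx N (l : nat -> nat) : 'M[R]_N :=
  \matrix_(i, j) ((l i) ^_ j)%:R.

Definition fact_prod N (l : nat -> nat) : R := \prod_(i < N) ((l i)`!)%:R.

Lemma fact_prod_neq0 N l : fact_prod N l != 0.
Proof. by apply/prodf_neq0 => i _; rewrite pnatr_eq0 -lt0n fact_gt0. Qed.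

Let natr_sub_ffact (l j : nat) : (l%:R - j%:R) * (l ^_ j)%:R = (l ^_ j.+1)%:R :> R.
Proof.
rewrite ffactnSr natrM mulrC; have [jl|lj] := leqP j l; first by rewrite natrB.
by rewrite ffact_small// !mul0r.
Qed.

Let ffact_up (l j : nat) : ((l.+1) ^_ j)%:R = (l ^_ j)%:R + j%:R * (l ^_ j.-1)%:R :> R.
Proof.
case: j => [|j]; first by rewrite !ffactn0 mul0r addr0.
rewrite /= ffactSS -natr_sub_ffact natrM -addn1 natrD -[j.+1]addn1 natrD.
by ring.
Qed.

(* Multiplying by [C] on the right scales column [j] by [be j] and adds [ga j]
   times the previous column. That last term does not enter the trace. *)
Let diag_col N (al be : 'I_N -> R) (ga : nat -> R) (A : 'M[R]_N) :
  exists C : 'M[R]_N, \tr C = \sum_j be j /\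
  forall i j, (diag_mx (\row_k al k) *m A + A *m C) i j =
    (al i + be j) * A i j +
    ga j * (if insub j.-1 is Some k then (if j == 0%N :> nat then 0 else A i k) else 0).
Proof.
exists (\matrix_(k, j) ((k == j)%:R * be j + (k.+1 == j :> nat)%:R * ga j)); split.
  apply: eq_bigr => j _; rewrite mxE eqxx mul1r.
  by rewrite (gtn_eqF (ltnSn j)) mul0r addr0.
move=> i j; rewrite mxE mul_diag_mx !mxE mulrDl -addrA; congr (_ + _).
under eq_bigr => k _ do rewrite mxE mulrDr.
rewrite big_split /=; congr (_ + _).
  by rewrite (bigD1 j)//= eqxx mul1r mulrC big1 ?addr0// => k /negPf ->; rewrite mul0r mulr0.
case: insubP => [k _ kj|]; last by rewrite (leq_ltn_trans (leq_pred j)).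
have [j0|j0] := eqVneq (j : nat) 0%N.
  by rewrite mulr0 big1// => m _; rewrite j0 mul0r mulr0.
rewrite (bigD1 k)//= kj prednK ?lt0n// eqxx mul1r mulrC big1 ?addr0// => m.
rewrite -val_eqE /= kj => mj; case: eqP => [mj'|]; last by rewrite mul0r mulr0.
by rewrite -mj' eqxx in mj.
Qed.

(** Since [l * (l - 1) ^_ j = (l - j) * l ^_ j], lowering row [i] with weight [l i]
    multiplies the entries of degree [j] by [l i - j]. *)
Lemma sum_ffact_down N (l : nat -> nat) :
  \sum_(i < N) (l i)%:R *
     \det (ffact_mx N (fun k => l k - (k == i))%N) =
  ((\sum_(i < N) l i)%:R - (\sum_(i < N) i)%:R) * \det (ffact_mx N l).
Proof.
have [C [trC eqC]] := diag_col (fun i : 'I_N => (l i)%:R) (fun j => - j%:R)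
  (fun _ => 0) (ffact_mx N l).
rewrite !natr_sum -sumrB big_split /= -trC -(sum_det_row_update (erefl _)).
apply: eq_bigr => i _.
have -> : ffact_mx N (fun k => l k - (k == i))%N =
    \matrix_(k, j) (if k == i then ((l i).-1 ^_ j)%:R else ffact_mx N l k j).
  apply/matrixP => k j; rewrite !mxE -val_eqE.
  by case: eqP => [->|]; rewrite ?subn1 ?subn0.
set A' := \matrix_(k, j) _.
have -> : (l i)%:R * \det A' = \det (\matrix_(k, j) (if k == i then (l i)%:R * A' i j else A' k j)).
  set B' := \matrix_(_, _) _.
  rewrite (@determinant_multilinear _ _ B' A' A' i (l i)%:R 0).
  - by rewrite mul0r addr0.
  - by apply/rowP => j; rewrite !mxE eqxx mul0r addr0.
  - by apply/matrixP => k j; rewrite !mxE eq_sym (negPf (neq_lift _ _)).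
  - by apply/matrixP => k j; rewrite !mxE eq_sym (negPf (neq_lift _ _)).
congr (\det _); apply/matrixP => k j; rewrite [LHS]mxE [RHS]mxE.
case: ifP => [_|ki]; last by rewrite mxE ki.
rewrite eqC mul0r addr0 !mxE eqxx -natrM -ffactnS -natr_sub_ffact.
by [].
Qed.

(** Since [(l + 1) ^_ j = l ^_ j + j * l ^_ j.-1], raising a row changes it by terms
    of lower degree. The weight [l i - N.-1] of the second sum is the content of
    the box that is added; with it, the diagonal term is [l i - N.-1 + j]. *)
Lemma sum_ffact_up N (l : nat -> nat) :
  \sum_(i < N) \det (ffact_mx N (fun k => l k + (k == i))%N) =
    N%:R * \det (ffact_mx N l) /\
  \sum_(i < N) ((l i)%:R - (N.-1)%:R) * \det (ffact_mx N (fun k => l k + (k == i))%N) =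
    ((\sum_(i < N) l i)%:R - (\sum_(i < N) i)%:R) * \det (ffact_mx N l).
Proof.
have rowE (i : 'I_N) : ffact_mx N (fun k => l k + (k == i))%N =
    \matrix_(k, j) (if k == i then ((l i).+1 ^_ j)%:R else ffact_mx N l k j).
  apply/matrixP => k j; rewrite !mxE -val_eqE.
  by case: eqP => [->|]; rewrite ?addn1 ?addn0.
have subE (i j : 'I_N) : j%:R * ((l i) ^_ j.-1)%:R = j%:R *
  (if insub j.-1 is Some k then (if j == 0%N :> nat then 0 else ffact_mx N l i k) else 0) :> R.
  case: insubP => [k _ kj|]; last by rewrite (leq_ltn_trans (leq_pred j)).
  by rewrite mxE kj; case: eqP => [->|//]; rewrite !mul0r.
split.
  have [C [trC eqC]] := diag_col (fun i : 'I_N => 1) (fun j => 0)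
    (fun j => j%:R) (ffact_mx N l).
  have -> : N%:R = \sum_(i < N) 1 + \tr C :> R.
    by rewrite trC sumr_const card_ord big1 ?addr0.
  rewrite -(sum_det_row_update (erefl _)).
  apply: eq_bigr => i _; rewrite rowE; congr (\det _).
  apply/matrixP => k j; rewrite [LHS]mxE [RHS]mxE; case: ifP => // _.
  by rewrite eqC addr0 mul1r ffact_up -subE mxE.
have [C [trC eqC]] := diag_col (fun i : 'I_N => (l i)%:R - (N.-1)%:R) (fun j => j%:R)
  (fun j => j%:R * (j%:R - N%:R)) (ffact_mx N l).
have -> : (\sum_(i < N) l i)%:R - (\sum_(i < N) i)%:R =
    \sum_(i < N) ((l i)%:R - (N.-1)%:R) + \tr C :> R.
  rewrite trC sumrB -!natr_sum -addrA sum_nat_const card_ord; congr (_ + _).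
  have sum2 : (\sum_(j < N) j + \sum_(j < N) j = N.-1 * N)%N.
    rewrite addnn; elim: N {l rowE subE C trC eqC} => [|N IH]; first by rewrite big_ord0.
    by rewrite big_ord_recr /= doubleD IH; case: N {IH} => //= N; lia.
  by rewrite mulnC -sum2 natrD opprD addrNK.
rewrite -(sum_det_row_update (erefl _)); apply: eq_bigr => i _.
rewrite rowE; set A' := \matrix_(k, j) _; set B' := \matrix_(_, _) _.
rewrite [RHS](@determinant_multilinear _ _ B' A' A' i ((l i)%:R - (N.-1)%:R) 0).
- by rewrite mul0r addr0.
- apply/rowP => j; rewrite scale0r addr0 [LHS]mxE [LHS]mxE eqxx eqC.
  rewrite [RHS]mxE [X in _ = _ * X]mxE [X in _ = _ * X]mxE eqxx ffact_up.
  rewrite [j%:R * (_ - _)]mulrC -mulrA -subE mxE.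
  case: (j : nat) => [|m]; first by rewrite !mul0r; ring.
  have -> : N%:R = (N.-1)%:R + 1 :> R by rewrite natr1 prednK// (leq_ltn_trans _ (ltn_ord i)).
  by rewrite -natr_sub_ffact /= -[m.+1%:R]natr1; ring.
- by apply/matrixP => k j; rewrite !mxE eq_sym (negPf (neq_lift _ _)).
- by apply/matrixP => k j; rewrite !mxE eq_sym (negPf (neq_lift _ _)).
Qed.

Definition dim_ratio N (l : nat -> nat) : R := \det (ffact_mx N l) / fact_prod N l.

Lemma shifted_rem_box (la : young) N (i : 'I_N) k : removable la (N.-1 - i)%N -> (k < N)%N ->
  shifted (rem_box la (N.-1 - i)%N) N k = (shifted la N k - (k == i))%N.
Proof.
move=> ri kN; rewrite /shifted part_rem_box//.
have -> : (N.-1 - k == N.-1 - i)%N = (k == i) by have := ltn_ord i; lia.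
case: eqP => [->|_]; last by rewrite !subn0.
by move: ri; rewrite /removable; lia.
Qed.

Lemma shifted_add_box (la : young) N (i : 'I_N) k : addable la (N.-1 - i)%N -> (k < N)%N ->
  shifted (add_box la (N.-1 - i)%N) N k = (shifted la N k + (k == i))%N.
Proof.
move=> ri kN; rewrite /shifted part_add_box//.
have -> : (N.-1 - k == N.-1 - i)%N = (k == i) by have := ltn_ord i; lia.
lia.
Qed.

Lemma sum_shifted (la : young) N : (ylength la <= N)%N ->
  (\sum_(i < N) shifted la N i)%:R - (\sum_(i < N) i)%:R = (ysize la)%:R :> R.
Proof.
move=> laN; rewrite big_split natrD addrK (ysizeE laN) (reindex_inj rev_ord_inj) /=.
by congr (_%:R); apply: eq_bigr => i _; congr (part la _); have := ltn_ord i; lia.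
Qed.

Let ffact_mx_eq N l l' : (forall i, (i < N)%N -> l i = l' i) -> ffact_mx N l = ffact_mx N l'.
Proof. by move=> e; apply/matrixP => i j; rewrite !mxE e. Qed.

Let fact_prod_eq N l l' : (forall i, (i < N)%N -> l i = l' i) -> fact_prod N l = fact_prod N l'.
Proof. by move=> e; apply: eq_bigr => i _; rewrite e. Qed.

Let det_ffact_same N (l : nat -> nat) (i j : 'I_N) : i != j -> l i = l j -> \det (ffact_mx N l) = 0.
Proof. by move=> ij e; apply: (determinant_alternate ij) => k; rewrite !mxE e. Qed.

Let fact_prod_up N (l : nat -> nat) (i : 'I_N) :
  fact_prod N (fun k => l k + (k == i))%N = (l i).+1%:R * fact_prod N l.
Proof.
rewrite /fact_prod (bigD1 i)//= [in RHS](bigD1 i)//= eqxx addn1 factS natrM -!mulrA.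
by congr (_ * (_ * _)); apply: eq_bigr => k /negPf; rewrite -val_eqE /= => ->; rewrite addn0.
Qed.

(** The recursion on removable boxes agrees with [sum_ffact_down], because a row
    that cannot be shortened contributes either the weight 0 or a determinant
    with two equal rows. *)
Lemma dim_ratioE (la : young) N : (ylength la <= N)%N ->
  (ydim la)%:R = ((ysize la)`!)%:R * dim_ratio N (shifted la N).
Proof.
elim: {la}(ysize la) {-2}la (erefl (ysize la)) => [|n IH] la sla laN.
  have part0 i : part la i = 0%N.
    apply/eqP; have := sla; rewrite (ysizeE (leq_maxl (ylength la) i.+1)) => /eqP.
    rewrite sum_nat_eq0 => /forallP/(_ (Ordinal (leq_maxr (ylength la) i.+1))).
    by rewrite implyTb.
  rewrite (ydim_size0 sla).
  rewrite /dim_ratio ?sla fact0 mul1r.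
  have shE i : (i < N)%N -> shifted la N i = i by move=> _; rewrite /shifted part0.
  rewrite (ffact_mx_eq shE) (fact_prod_eq shE) det_trig; last first.
    apply/is_trig_mxP => i j ij; rewrite mxE ffact_small//.
  rewrite (eq_bigr (fun i : 'I_N => (i`!)%:R)).
    by rewrite divff// (fact_prod_neq0 N id).
  by move=> i _; rewrite mxE ffactnn.
rewrite (ydim_rec _ laN) ?sla// natr_sum.
have key : \sum_(r < N | removable la r) dim_ratio N (shifted (rem_box la r) N) =
    n.+1%:R * dim_ratio N (shifted la N).
  rewrite -sla -(sum_shifted laN) /dim_ratio mulrA -sum_ffact_down mulr_suml.
  rewrite big_mkcond (reindex_inj rev_ord_inj) /=; apply: eq_bigr => i _.
  have -> : (N - i.+1 = N.-1 - i)%N by have := ltn_ord i; lia.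
  set l := shifted la N.
  have [ri|nri] := boolP (removable la (N.-1 - i)%N).
    have li : (0 < l i)%N.
      by move: ri; rewrite /l /shifted /removable; lia.
    have shE k : (k < N)%N -> shifted (rem_box la (N.-1 - i)%N) N k = (l k - (k == i))%N.
      exact: shifted_rem_box.
    rewrite (ffact_mx_eq shE) (fact_prod_eq shE).
    have -> : fact_prod N l = (l i)%:R * fact_prod N (fun k => l k - (k == i))%N.
      rewrite -[in RHS](prednK li) -[X in X.-1.+1%:R](subn0 (l i)).
      have := fact_prod_up (fun k => l k - (k == i))%N i; rewrite /= eqxx subn1 subn0 => <-.
      apply: fact_prod_eq => k _; case: eqP => [->|_]; last by rewrite subn0 addn0.
      by rewrite subnK.
    by rewrite invfM mulrACA divff ?mul1r// pnatr_eq0 -lt0n.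
  have [l0|l0] := posnP (l i); first by rewrite l0 !mul0r.
  have ppos := nri; rewrite /removable -leqNgt in ppos.
  have i0 : (0 < i)%N.
    rewrite lt0n; apply: contraTneq l0 => i0; rewrite -leqNgt /l /shifted i0 addn0 subn0.
    have := ppos; rewrite i0 subn0 prednK ?(leq_ltn_trans _ (ltn_ord i))//.
    by move=> /leq_trans; apply; rewrite leqn0 part_eq0.
  have i'N : (i.-1 < N)%N by have := ltn_ord i; lia.
  suff -> : \det (ffact_mx N (fun k => l k - (k == i))%N) = 0 by rewrite mulr0 mul0r.
  apply: (@det_ffact_same _ _ i (Ordinal i'N)); first by rewrite -val_eqE /=; lia.
  rewrite /= eqxx /l /shifted; have -> : (i.-1 == i :> nat) = false by lia.
  have E : (N.-1 - i.-1 = (N.-1 - i)%N.+1)%N by have := ltn_ord i; lia.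
  have -> : part la (N.-1 - i.-1) = part la (N.-1 - i)%N.
    by apply/eqP; rewrite eqn_leq E ppos part_noninc.
  by lia.
have ydim_rem (r : 'I_N) : removable la r ->
    (ydim (rem_box la r))%:R = (n`!)%:R * dim_ratio N (shifted (rem_box la r) N).
  move=> rr; have sr : ysize (rem_box la r) = n.
    by apply/eqP; rewrite -eqSS -ysize_rem_box// sla.
  have rN : (ylength (rem_box la r) <= N)%N.
    rewrite -part_eq0 part_rem_box//.
    by have /eqP -> : part la N == 0%N by rewrite part_eq0.
  by rewrite (IH _ sr rN) ?sr.
by rewrite (eq_bigr _ ydim_rem) -mulr_sumr key mulrA -natrM mulnC.
Qed.

(** Adding boxes weighted by the polynomials 1, [c] and [c ^ 2] of the content [c]
    multiplies [dim / n!] by 1, 0 and [n]. The determinant only yields the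
    weights [N + c] and [(N + c) * c], but it does so for every large [N]. *)
Lemma sum_content_add_box (la : young) (s t : R) :
  \sum_(r < (ylength la).+1 | addable la r)
     (((part la r)%:R - r%:R) ^+ 2 + s * ((part la r)%:R - r%:R) + t) *
     (ydim (add_box la r))%:R =
  (ysize la).+1%:R * (t + (ysize la)%:R) * (ydim la)%:R.
Proof.
pose c r : R := (part la r)%:R - r%:R.
set n := ysize la; set m := (ylength la).+1.
pose S k := \sum_(r < m | addable la r) c r ^+ k * (ydim (add_box la r))%:R.
have ydim_add N r : (m <= N)%N -> addable la r ->
    (ydim (add_box la r))%:R = (n.+1`!)%:R * dim_ratio N (shifted (add_box la r) N).
  move=> mN ar; rewrite (@dim_ratioE _ N) ?ysize_add_box//.
  rewrite -part_eq0 part_add_box//.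
  have /eqP -> : part la N == 0%N by rewrite part_eq0 ltnW.
  by have := addable_leq_ylength ar; rewrite add0n eqb0; apply: contraTneq => <-; rewrite -ltnNge.
have sumE N (g : R -> R) : (m <= N)%N ->
    \sum_(r < m | addable la r) (N%:R + c r) * g (c r) * (ydim (add_box la r))%:R =
    (n.+1`!)%:R * ((\sum_(i < N) g ((shifted la N i)%:R - (N.-1)%:R) *
      \det (ffact_mx N (fun k => shifted la N k + (k == i))%N)) / fact_prod N (shifted la N)).
  move=> mN.
  transitivity (\sum_(r < N | addable la r) (N%:R + c r) * g (c r) * (ydim (add_box la r))%:R).
    rewrite [LHS](big_ord_widen_cond N (addable la)
      (fun r => (N%:R + c r) * g (c r) * (ydim (add_box la r))%:R))//.
    apply: eq_bigl => r.
    by case ar: addable => //=; rewrite ltnS addable_leq_ylength.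
  rewrite big_mkcond mulr_suml mulr_sumr (reindex_inj rev_ord_inj) /=.
  apply: eq_bigr => i _; have iN := ltn_ord i.
  have -> : (N - i.+1 = N.-1 - i)%N by lia.
  have cE : c (N.-1 - i)%N = (shifted la N i)%:R - (N.-1)%:R.
    rewrite /c /shifted natrD natrB; [by ring|by lia].
  have NE : N%:R = (N.-1)%:R + 1 :> R by rewrite natr1 prednK//; lia.
  have [ai|nai] := boolP (addable _ _).
    have shE k : (k < N)%N -> shifted (add_box la (N.-1 - i)%N) N k =
        (shifted la N k + (k == i))%N by exact: shifted_add_box.
    rewrite (ydim_add N)// /dim_ratio (ffact_mx_eq shE) (fact_prod_eq shE) fact_prod_up.
    rewrite cE NE [_ + 1 + _]addrC addrA subrK natr1.
    have l0 : (shifted la N i).+1%:R != 0 :> R by rewrite pnatr_eq0.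
    have := fact_prod_neq0 N (shifted la N); move: (fact_prod _ _) l0 => f.
    move: (_.+1%:R) => l l0 f0; move: (\det _) => d.
    by field; rewrite f0 l0.
  suff -> : \det (ffact_mx N (fun k => shifted la N k + (k == i))%N) = 0.
    by rewrite mulr0 mul0r mulr0.
  move: nai; rewrite /addable negb_or -leqNgt => /andP[i0 ple].
  have i'N : (i.+1 < N)%N by lia.
  apply: (@det_ffact_same _ _ i (Ordinal i'N)); first by rewrite -val_eqE /=; lia.
  rewrite /= eqxx /shifted; have -> : (i.+1 == i :> nat) = false by lia.
  have E : (N.-1 - i.+1 = (N.-1 - i)%N.-1)%N by lia.
  have -> : part la (N.-1 - i.+1) = part la (N.-1 - i)%N.
    by apply/eqP; rewrite eqn_leq E ple part_noninc// leq_pred.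
  by lia.
have dimE N : (m <= N)%N -> (ydim la)%:R =
    (n`!)%:R * (\det (ffact_mx N (shifted la N)) / fact_prod N (shifted la N)).
  by move=> mN; rewrite (@dim_ratioE _ N)// ltnW.
have Srec N k : N%:R * S k + S k.+1 =
    \sum_(r < m | addable la r) (N%:R + c r) * c r ^+ k * (ydim (add_box la r))%:R.
  rewrite /S mulr_sumr -big_split; apply: eq_bigr => r _ /=.
  by rewrite exprS; ring.
have U1 N : (m <= N)%N -> N%:R * S 0 + S 1 = N%:R * (n.+1%:R * (ydim la)%:R).
  move=> mN; rewrite Srec (sumE N (fun x => x ^+ 0) mN) (dimE N mN).
  under eq_bigr => i _ do rewrite expr0 mul1r.
  by have [-> _] := sum_ffact_up N (shifted la N); rewrite factS natrM; ring.
have U2 N : (m <= N)%N -> N%:R * S 1 + S 2 = n%:R * (n.+1%:R * (ydim la)%:R).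
  move=> mN; rewrite Srec (sumE N (fun x => x ^+ 1) mN) (dimE N mN).
  under eq_bigr => i _ do rewrite expr1.
  have [_ ->] := sum_ffact_up N (shifted la N).
  by rewrite sum_shifted ?(ltnW mN)// factS natrM; ring.
have := U1 m (leqnn m); have := U1 m.+1 (leqnSn m); have := U2 m (leqnn m).
rewrite -[m.+1%:R]natr1 => e2 e1' e1.
(* solve the system given by [N = m] and [N = m.+1] *)
have S0 : S 0 = n.+1%:R * (ydim la)%:R by lra.
have S1 : S 1 = 0 by move: e1; rewrite S0; lra.
have S2 : S 2 = n%:R * (n.+1%:R * (ydim la)%:R) by move: e2; rewrite S1; lra.
transitivity (S 2 + s * S 1 + t * S 0); last by rewrite S0 S1 S2; ring.
rewrite /S !mulr_sumr -!big_split; apply: eq_bigr => r _ /=.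
by rewrite expr0 expr1 -/(c r); ring.
Qed.

End Dimension.

(** * The weight of the partitions of a given size *)

Fixpoint level (n : nat) : seq young :=
  if n is m.+1 then
    undup (flatten [seq [seq add_box la i | i <- iota 0 (ylength la).+1 & addable la i]
                   | la <- level m])
  else [:: young_empty].

Lemma level_uniq n : uniq (level n).
Proof. by case: n => [//|n]; exact: undup_uniq. Qed.

Lemma ysize_eq0 (la : young) : (ysize la == 0)%N = (la == young_empty).
Proof.
apply/idP/eqP => [/eqP s0|->//]; apply: part_inj => i.
rewrite [RHS]nth_nil; apply/eqP; have := s0; rewrite (ysizeE (leq_maxl _ i.+1)) => /eqP.
rewrite sum_nat_eq0 => /forallP/(_ (Ordinal (leq_maxr _ _))).
by rewrite implyTb.
Qed.

Lemma mem_level n la : (la \in level n) = (ysize la == n).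
Proof.
elim: n la => [|n IH] la; first by rewrite inE ysize_eq0.
rewrite mem_undup; apply/flatten_mapP/eqP => [[mu]|sla].
  rewrite IH => /eqP sm lam; case: (elimT (@mapP nat young _ _ _) lam) => i.
  rewrite mem_filter => /andP[ai _] ->.
  by rewrite ysize_add_box// sm.
have [i ri] : exists i, removable la i by apply: exists_removable; rewrite sla.
have := add_box_rem_box (rem_box la i) la i; rewrite ri eqxx => /esym/andP[ai /eqP lE].
exists (rem_box la i); first by rewrite IH -eqSS -ysize_rem_box// sla.
apply: (introT (@mapP nat young _ _ _)); exists i => //.
by rewrite mem_filter ai mem_iota /= add0n ltnS addable_leq_ylength.
Qed.

Lemma ylength_le_ysize (la : young) : (ylength la <= ysize la)%N.
Proof.
rewrite (ysizeE (leqnn _)) -[leqLHS]card_ord -sum1_card; apply: leq_sum => i _.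
by rewrite lt0n part_eq0 -ltnNge.
Qed.

Section LevelWeight.
Variables (R : realFieldType) (q : R -> R).

(** For [q c = (z + c) * (z' + c)], this is the product of the two generalized
    rising factorials of the weight of [la]. *)
Definition content_prod (la : young) : R :=
  \prod_(i < ylength la) \prod_(j < part la i) q (j%:R - i%:R).

Lemma content_prodE (la : young) N : (ylength la <= N)%N ->
  content_prod la = \prod_(i < N) \prod_(j < part la i) q (j%:R - i%:R).
Proof.
move=> laN; rewrite /content_prod -(subnKC laN) big_split_ord /= [X in _ * X]big1 ?mulr1//.
move=> i _; have /eqP -> : part la (ylength la + i) == 0%N by rewrite part_eq0 leq_addr.
by rewrite big_ord0.
Qed.

Lemma content_prod_add_box (la : young) i : addable la i ->
  content_prod (add_box la i) = q ((part la i)%:R - i%:R) * content_prod la.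
Proof.
move=> ai; set N := maxn (ylength la).+1 (ylength (add_box la i)).
have iN : (i < N)%N by rewrite (leq_trans _ (leq_maxl _ _))// ltnS addable_leq_ylength.
rewrite (@content_prodE _ N) ?leq_maxr// (@content_prodE la N); last first.
  by rewrite ltnW// leq_maxl.
rewrite (bigD1 (Ordinal iN))//= [in RHS](bigD1 (Ordinal iN))//= mulrA.
rewrite part_add_box// eqxx addn1 big_ord_recr /= [q _ * _]mulrC.
congr (_ * _); apply: eq_bigr => k; rewrite -val_eqE /= => /negPf ki.
by rewrite part_add_box// ki addn0.
Qed.

Hypothesis q_quadratic : exists s, forall c, q c = c ^+ 2 + s * c + q 0.

Let pred1_sum (r : seq young) (x : young) (F : young -> R) : uniq r -> x \in r ->
  \sum_(y <- r | y == x) F y = F x.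
Proof.
move=> ur xr; rewrite big_mkcond (bigD1_seq x)//= eqxx big1 ?addr0// => y.
by move=> /negPf ->.
Qed.

(** Each diagram is reached from those with one box less; summing the recursion
    [ydim_rec] over a level and exchanging the sums leaves
    [sum_content_add_box]. *)
Lemma level_weight_rec n :
  \sum_(la <- level n.+1) content_prod la * (ydim la)%:R ^+ 2 =
  n.+1%:R * (q 0 + n%:R) * \sum_(la <- level n) content_prod la * (ydim la)%:R ^+ 2.
Proof.
have [s qE] := q_quadratic.
pose G (la mu : young) : R := content_prod mu * (ydim mu)%:R * (ydim la)%:R.
transitivity (\sum_(mu <- level n.+1) \sum_(i < n.+1) \sum_(la <- level n)
    if removable mu i && (la == rem_box mu i) then G la mu else 0).
  apply: eq_big_seq => mu; rewrite mem_level => /eqP smu.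
  rewrite expr2 mulrA {2}(@ydim_rec mu n.+1) ?smu//; last first.
    by rewrite -smu ylength_le_ysize.
  rewrite natr_sum mulr_sumr big_mkcond; apply: eq_bigr => i _.
  rewrite -big_mkcond; case: ifP => [ri|_]; last by rewrite big_pred0.
  have rl : rem_box mu i \in level n by rewrite mem_level -eqSS -ysize_rem_box// smu.
  by rewrite (pred1_sum _ (level_uniq n) rl).
rewrite exchange_big /=; under eq_bigr => i _ do rewrite exchange_big /=.
rewrite exchange_big /= mulr_sumr; apply: eq_big_seq => la; rewrite mem_level => /eqP sla.
transitivity (\sum_(i < n.+1 | addable la i) G la (add_box la i)).
  rewrite [RHS]big_mkcond; apply: eq_bigr => i _.
  under eq_bigr => mu _ do rewrite add_box_rem_box.
  rewrite -big_mkcond; case: ifP => [ai|_]; last by rewrite big_pred0.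
  have al : add_box la i \in level n.+1 by rewrite mem_level ysize_add_box// sla.
  by rewrite (pred1_sum _ (level_uniq n.+1) al).
transitivity (content_prod la * (ydim la)%:R *
    ((ysize la).+1%:R * (q 0 + (ysize la)%:R) * (ydim la)%:R)); last first.
  by rewrite sla; ring.
rewrite -(@sum_content_add_box _ _ s) mulr_sumr.
have ln : ((ylength la).+1 <= n.+1)%N by rewrite ltnS -sla ylength_le_ysize.
rewrite [RHS](big_ord_widen_cond n.+1 (addable la) (fun i => content_prod la * (ydim la)%:R *
  ((((part la i)%:R - i%:R) ^+ 2 + s * ((part la i)%:R - i%:R) + q 0) * (ydim (add_box la i))%:R)))//.
apply: eq_big => i; first by case ai: addable => //=; rewrite ltnS addable_leq_ylength.
by move=> ai; rewrite /G content_prod_add_box// qE; ring.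
Qed.

Lemma level_weight n :
  \sum_(la <- level n) content_prod la * ((ydim la)%:R / (n`!)%:R) ^+ 2 =
  (\prod_(j < n) (q 0 + j%:R)) / (n`!)%:R.
Proof.
transitivity ((\sum_(la <- level n) content_prod la * (ydim la)%:R ^+ 2) / (n`!)%:R ^+ 2).
  by rewrite mulr_suml; apply: eq_bigr => la _; rewrite expr_div_n mulrA.
have f0 k : (k`!)%:R != 0 :> R by rewrite pnatr_eq0 -lt0n fact_gt0.
suff -> : \sum_(la <- level n) content_prod la * (ydim la)%:R ^+ 2 =
    (n`!)%:R * \prod_(j < n) (q 0 + j%:R).
  by have := f0 n; move: (_`!%:R) => f; move=> ?; field.
elim: n => [|n IH].
  by rewrite big_seq1 /content_prod !big_ord0 fact0 !mul1r ydim_size0// expr1n.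
by rewrite level_weight_rec IH big_ord_recr factS natrM /=; ring.
Qed.

End LevelWeight.

(** * Diagrams in a rectangle as point configurations in a window *)

Definition boxed N M : seq young :=
  [seq la <- undup (flatten [seq level n | n <- iota 0 (N * M).+1])
  | (ylength la <= N)%N && (part la 0 <= M)%N].

Lemma boxed_uniq N M : uniq (boxed N M).
Proof. by rewrite filter_uniq// undup_uniq. Qed.

Lemma mem_boxed N M la : (la \in boxed N M) = (ylength la <= N)%N && (part la 0 <= M)%N.
Proof.
rewrite mem_filter mem_undup; apply/andP/idP => [[]//|lab]; split=> //.
move/andP: lab => [laN laM]; apply/flatten_mapP; exists (ysize la); last by rewrite mem_level.
rewrite mem_iota add0n ltnS (ysizeE laN).
apply: (@leq_trans (\sum_(i < N) M)%N); last by rewrite sum_nat_const card_ord.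
by apply: leq_sum => i _; rewrite (leq_trans _ laM)// part_noninc.
Qed.

(** The [N] rightmost points of the Maya diagram, in coordinates in which those of
    the empty diagram are [0, ..., N.-1]. *)
Definition positions (la : young) N : seq nat := mkseq (shifted la N) N.

Lemma positions_sorted la N : sorted ltn (positions la N).
Proof.
apply/(sortedP 0%N) => i; rewrite size_mkseq => iN.
rewrite !nth_mkseq ?(ltnW iN)// /shifted.
by have := part_noninc la (leq_sub2l N.-1 (leqnSn i)); rewrite /=; lia.
Qed.

Lemma positions_inj la mu N : (ylength la <= N)%N -> (ylength mu <= N)%N ->
  positions la N =i positions mu N -> la = mu.
Proof.
move=> laN muN /(irr_sorted_eq ltn_trans ltnn (positions_sorted _ _) (positions_sorted _ _)) E.
apply: part_inj => r; have [rN|Nr] := ltnP r N; last first.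
  have /eqP -> : part la r == 0%N by rewrite part_eq0 (leq_trans laN).
  by have /eqP -> : part mu r == 0%N by rewrite part_eq0 (leq_trans muN).
have kN : (N.-1 - r < N)%N by lia.
have := congr1 (fun s => nth 0%N s (N.-1 - r)%N) E.
rewrite !nth_mkseq// /shifted; have -> : (N.-1 - (N.-1 - r) = r)%N by lia.
by move=> /eqP; rewrite eqn_add2r => /eqP.
Qed.

Lemma positions_bound la N M i : la \in boxed N M -> (i < N)%N -> (shifted la N i < N + M)%N.
Proof.
rewrite mem_boxed => /andP[_ laM] iN; rewrite /shifted.
by have := part_noninc la (leq0n (N.-1 - i)); lia.
Qed.

Lemma boxed_of_sorted N M (e : seq nat) : sorted ltn e -> size e = N ->
  all (gtn (N + M)) e -> exists2 la, la \in boxed N M & positions la N = e.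
Proof.
move=> se ze ae.
have e_lt i j : (i < j)%N -> (j < N)%N -> (nth 0 e i < nth 0 e j)%N.
  move=> ij jN; have := sorted_ltn_nth ltn_trans 0%N se.
  by apply=> //; rewrite inE ze// (ltn_trans ij).
have e_ge i : (i < N)%N -> (i <= nth 0 e i)%N.
  elim: i => [//|i IH] iN; have := e_lt _ _ (ltnSn i) iN; have := IH (ltnW iN); lia.
have e_le i : (i < N)%N -> (nth 0 e i < N + M)%N.
  by move=> iN; apply: (allP ae); rewrite mem_nth// ze.
have e_mono i : (i.+1 < N)%N -> (nth 0 e i - i <= nth 0 e i.+1 - i.+1)%N.
  by move=> iN; have := e_lt _ _ (ltnSn i) iN; have := e_ge _ (ltnW iN); lia.
pose f r := if (r < N)%N then (nth 0 e (N.-1 - r) - (N.-1 - r))%N else 0%N.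
have fE r : part (young_of f N) r = f r.
  apply: part_young_of => [j|]; last by rewrite /f ltnn.
  rewrite /f; case: ifP => [jN|//]; rewrite (ltnW jN).
  have -> : (N.-1 - j = (N.-1 - j.+1).+1)%N by lia.
  by apply: e_mono; lia.
exists (young_of f N).
  rewrite mem_boxed -part_eq0 !fE /f ltnn eqxx /=; case: ifP => // N0.
  by rewrite subn0; have := e_le N.-1; rewrite ltn_predL => /(_ N0); lia.
apply: (@eq_from_nth _ 0%N); rewrite size_mkseq// => i iN.
rewrite nth_mkseq// /shifted fE /f.
have -> : (N.-1 - i < N)%N by lia.
have -> : (N.-1 - (N.-1 - i) = i)%N by lia.
by rewrite subnK// e_ge.
Qed.

Section Window.
Variables (N M : nat).

Let codom_perm (la : young) (f : {ffun 'I_N -> 'I_(N + M)}) : bool :=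
  perm_eq (map val (codom f)) (positions la N).

Let codom_perm_exists (la : young) (f : {ffun 'I_N -> 'I_(N + M)}) : codom_perm la f ->
  exists s : 'S_N, forall i, val (f i) = shifted la N (s i).
Proof.
move=> pf; have sz : size (positions la N) == N by rewrite size_mkseq.
have sz' : size (map val (codom f)) == N by rewrite size_map size_codom card_ord.
have /tuple_permP[s sE] : perm_eq (Tuple sz') (Tuple sz) by [].
exists s => i; have := congr1 (fun t => nth 0%N t i) sE.
rewrite /= (nth_map (f i)) ?size_codom ?card_ord// codomE (nth_map i) ?size_enum_ord//.
rewrite nth_ord_enum => ->; rewrite (nth_map i) ?size_enum_ord// nth_ord_enum.
by rewrite (tnth_nth 0%N) /= nth_mkseq.
Qed.

Lemma card_codom_perm la : la \in boxed N M -> #|[pred f | codom_perm la f]| = N`!.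
Proof.
move=> lab; pose g (s : 'S_N) : {ffun 'I_N -> 'I_(N + M)} :=
  [ffun i => Ordinal (positions_bound lab (ltn_ord (s i)))].
have sh_inj i j : (i < N)%N -> (j < N)%N -> shifted la N i = shifted la N j -> i = j.
  move=> iN jN e; have := sorted_uniq ltn_trans ltnn (positions_sorted la N).
  by move/uniqP => /(_ 0%N i j); rewrite !inE size_mkseq !nth_mkseq//; apply.
have injg : injective g.
  move=> s s' e; apply/permP => i; apply/val_inj/sh_inj; rewrite ?ltn_ord//.
  by have := congr1 (fun f : {ffun _ -> _} => val (f i)) e; rewrite !ffunE.
rewrite -card_Sn -cardsT -(card_imset _ injg); apply: eq_card => f; rewrite inE.
apply/idP/imsetP => [/codom_perm_exists[s sE]|[s _ ->]].
  by exists s => //; apply/ffunP => i; apply: val_inj; rewrite ffunE /= sE.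
apply: uniq_perm.
- rewrite map_inj_uniq; last exact: val_inj.
  apply/injectiveP => i j; rewrite !ffunE => /(congr1 val)/= /sh_inj e.
  by apply: (@perm_inj _ s); apply: val_inj; apply: e.
- exact: sorted_uniq ltn_trans ltnn _ (positions_sorted la N).
- move=> x; apply/mapP/mapP => -[].
    move=> y /codomP[i ->] ->.
    by exists (val (s i)); rewrite ?mem_iota ?ffunE//=.
  move=> i.
  rewrite mem_iota /= add0n => iN ->; exists (g s ((s^-1)%g (Ordinal iN))); first exact: codom_f.
  by rewrite ffunE /= permKV.
Qed.

(** Injective [f] are the labelled configurations of [N] particles; each
    configuration comes from one diagram and has [N`!] labellings. *)
Lemma sum_boxed (R : realFieldType) (F : {ffun 'I_N -> 'I_(N + M)} -> R) (G : young -> R) :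
  (forall f : {ffun 'I_N -> 'I_(N + M)}, ~ injective f -> F f = 0) ->
  (forall (f : {ffun 'I_N -> 'I_(N + M)}) la (s : 'S_N), la \in boxed N M ->
     (forall i, val (f i) = shifted la N (s i)) ->
     F f = G la) ->
  \sum_f F f = (N`!)%:R * \sum_(la <- boxed N M) G la.
Proof.
move=> F0 FG.
transitivity (\sum_f \sum_(la <- boxed N M) if codom_perm la f then F f else 0).
  apply: eq_bigr => f _; have [injf|ninjf] := boolP (injectiveb f); last first.
    by rewrite F0 ?big1 ?if_same// => [la _|/injectiveP]; [rewrite if_same|apply/negP].
  pose e := sort leq (map val (codom f)).
  have ue : uniq (map val (codom f)) by rewrite map_inj_uniq//; exact: val_inj.
  have pe : perm_eq (map val (codom f)) e by rewrite perm_sym perm_sort.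
  have se : sorted ltn e.
    by rewrite ltn_sorted_uniq_leq sort_uniq ue; apply: sort_sorted leq_total _.
  have [||la lab posE] := @boxed_of_sorted N M e se.
  - by rewrite size_sort size_map size_codom card_ord.
  - apply/allP => x; rewrite mem_sort => /mapP[y _ ->] /=; exact: ltn_ord.
  rewrite -big_mkcond -big_filter.
  rewrite (_ : [seq _ <- _ | _] = [:: la]) ?big_seq1//.
  apply: perm_small_eq => //; apply: uniq_perm => //.
    by rewrite filter_uniq// boxed_uniq.
  move=> mu; rewrite mem_filter inE; apply/andP/eqP => [[pmu mub]|->]; last first.
    by rewrite /codom_perm posE.
  move: lab mub; rewrite !mem_boxed => /andP[laN _] /andP[muN _].
  apply: positions_inj muN laN _; apply: perm_mem; rewrite posE.
  by apply: perm_trans pe; rewrite perm_sym.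
rewrite exchange_big /= mulr_sumr; apply: eq_big_seq => la lab.
rewrite -big_mkcond /= (eq_bigr (fun=> G la)).
  by rewrite sumr_const card_codom_perm// mulr_natl.
by move=> f /codom_perm_exists[s sE]; exact: FG sE.
Qed.

End Window.

(** * Correlations in a window *)

Definition box_weight (R : realFieldType) (q : R -> R) (xi : R) (la : young) : R :=
  xi ^+ ysize la * content_prod q la * ((ydim la)%:R / ((ysize la)`!)%:R) ^+ 2.

Section WindowWeight.
Variables (R : rcfType) (q : R -> R) (xi : R) (N M : nat).
Hypothesis xi_gt0 : 0 < xi.
Hypothesis q_gt0 : forall c : nat, (c.+1 < N + M)%N -> 0 < q (c%:R - (N.-1)%:R).

(** The product of [q] over the contents [1 - N, ..., l - N], that is, over the
    boxes crossed by a particle that moves from position 0 to position [l]. *)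
Definition content_fact (l : nat) : R := \prod_(c < l) q (c%:R - (N.-1)%:R).

Definition site_weight (l : nat) : R := xi ^+ l * content_fact l / (l`!)%:R ^+ 2.

(** A diagram in the [N] by [M] rectangle has weight proportional to the squared
    maximal minor of this matrix on its positions. *)
Definition window_mx : 'M[R]_(N + M, N) :=
  \matrix_(x, j) (Num.sqrt (site_weight x) * (x ^_ j)%:R).

Definition window_const : R := (\prod_(i < N) (xi ^+ i * content_fact i))^-1.

Lemma content_fact_gt0 l : (l < N + M)%N -> 0 < content_fact l.
Proof.
move=> lL; apply: prodr_gt0 => c _; apply: q_gt0.
exact: leq_ltn_trans (ltn_ord c) lL.
Qed.

Lemma site_weight_ge0 l : (l < N + M)%N -> 0 <= site_weight l.
Proof.
move=> lL; apply: divr_ge0; last exact: sqr_ge0.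
by rewrite mulr_ge0// ltW// ?exprn_gt0// content_fact_gt0.
Qed.

Lemma box_weight_minor la : la \in boxed N M ->
  box_weight q xi la = window_const *
   \det (\matrix_(i < N, j < N) (Num.sqrt (site_weight (shifted la N i)) *
                                 ((shifted la N i) ^_ j)%:R)) ^+ 2.
Proof.
move=> lab; have := lab; rewrite mem_boxed => /andP[laN laM].
have shL := positions_bound lab.
set l := shifted la N.
have -> : \matrix_(i < N, j < N) (Num.sqrt (site_weight (l i)) * ((l i) ^_ j)%:R) =
    diag_mx (\row_i Num.sqrt (site_weight (l i))) *m ffact_mx R N l.
  by apply/matrixP => i j; rewrite mul_diag_mx !mxE.
rewrite det_mulmx det_diag exprMn.
have -> : (\prod_(i < N) (\row_i Num.sqrt (site_weight (l i))) 0 i) ^+ 2 =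
    \prod_(i < N) site_weight (l i).
  rewrite -prodrXl; apply: eq_bigr => i _; rewrite mxE sqr_sqrtr//.
  by rewrite site_weight_ge0// shL.
rewrite /box_weight (@dim_ratioE R la N laN) [_`!%:R * _]mulrC mulfK; last first.
  by rewrite pnatr_eq0 -lt0n fact_gt0.
rewrite /dim_ratio expr_div_n [_ / _ ^+ 2]mulrC [LHS]mulrA [RHS]mulrA; congr (_ * _).
rewrite /fact_prod -prodrXl (ysizeE laN) -prodrXr (content_prodE _ laN).
rewrite (reindex_inj rev_ord_inj) [X in _ * X / _](reindex_inj rev_ord_inj) /=.
rewrite -big_split -prodf_div /window_const -prodfV -big_split /=.
apply: eq_bigr => i _; rewrite /site_weight.
have iN := ltn_ord i; have -> : (N - i.+1 = N.-1 - i)%N by lia.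
set p := part la (N.-1 - i).
rewrite -/(l i); have -> : l i = (i + p)%N by rewrite /l /shifted addnC.
have cfE : content_fact (i + p) = content_fact i * \prod_(j < p) q (j%:R - (N.-1 - i)%:R).
  rewrite /content_fact big_split_ord /=; congr (_ * _); apply: eq_bigr => j _.
  congr q; rewrite natrD natrB; [ring | lia].
have xi0 : xi ^+ i != 0 by rewrite lt0r_neq0// exprn_gt0.
have c0 : content_fact i != 0.
  by rewrite lt0r_neq0// content_fact_gt0// (leq_trans iN)// leq_addr.
have f0 : ((i + p)`!)%:R != 0 :> R by rewrite pnatr_eq0 -lt0n fact_gt0.
rewrite cfE exprD; move: (_`!%:R) (content_fact i) (xi ^+ i) (xi ^+ p) (\prod_(j < p) _) f0 c0 xi0.
by move=> f c x y r f0 c0 xi0; field; rewrite f0 c0 xi0.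
Qed.

Lemma window_const_gt0 : 0 < window_const.
Proof.
rewrite invr_gt0; apply: prodr_gt0 => i _; rewrite mulr_gt0 ?exprn_gt0//.
by rewrite content_fact_gt0// (leq_trans (ltn_ord i))// leq_addr.
Qed.

Lemma box_weight_ge0 la : la \in boxed N M -> 0 <= box_weight q xi la.
Proof. by move=> lab; rewrite box_weight_minor// mulr_ge0 ?sqr_ge0// ltW// window_const_gt0. Qed.

Lemma box_weight_empty : box_weight q xi young_empty = 1.
Proof.
by rewrite /box_weight /content_prod !big_ord0 ydim_size0// fact0 divr1 expr1n !mul1r.
Qed.

Section Correlation.
Variables (n : nat) (pos : 'I_n -> 'I_(N + M) + bool).

Definition diagram_hit (la : young) : bool :=
  [forall i, match pos i with inl u => val u \in positions la N | inr b => b end].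

Lemma sum_window_minors : \sum_(f : {ffun 'I_N -> 'I_(N + M)} | marks_hit pos f)
     \det (rowsub f window_mx) ^+ 2 =
  (N`!)%:R * (window_const^-1 *
     \sum_(la <- boxed N M | diagram_hit la) box_weight q xi la).
Proof.
rewrite big_mkcond mulr_sumr [in RHS]big_mkcond; apply: sum_boxed.
  move=> f ninjf; have [i [j ij fij]] : exists i, exists2 j, i != j & f i = f j.
    by apply/injectivePn/negP => /injectiveP.
  rewrite (_ : \det _ = 0) ?expr0n ?if_same//.
  by apply: (determinant_alternate ij) => k; rewrite !mxE fij.
move=> f la s lab fE; have -> : marks_hit pos f = diagram_hit la.
  apply: eq_forallb => i; case: (pos i) => // u; apply/existsP/mapP => -[].
    by move=> k /eqP <-; exists (val (s k)); rewrite ?mem_iota ?fE//=.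
  move=> k; rewrite mem_iota /= add0n => kN uE; exists ((s^-1)%g (Ordinal kN)).
  by apply/eqP/val_inj; rewrite /= fE permKV uE.
case: ifP => // _; rewrite box_weight_minor// mulKf ?lt0r_neq0 ?window_const_gt0//.
set A := \matrix_(_, _) _; have -> : rowsub f window_mx = row_perm s A.
  by apply/matrixP => i j; rewrite !mxE -fE.
by rewrite row_permE det_mulmx det_perm exprMn sqrr_sign mul1r.
Qed.

End Correlation.

(** The empty diagram alone makes the sum of the squared minors positive. *)
Lemma window_gram_unit : gram window_mx \in unitmx.
Proof.
have sum_gt0 : 0 < \sum_(la <- boxed N M) box_weight q xi la.
  have eb : young_empty \in boxed N M by rewrite mem_boxed.
  rewrite (bigD1_seq _ eb (boxed_uniq N M)) /= box_weight_empty ltr_pwDl// big_seq_cond.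
  by apply: sumr_ge0 => la /andP[lab _]; exact: box_weight_ge0.
pose pos0 : 'I_0 -> 'I_(N + M) + bool := fun=> inr true.
have E := sum_window_minors pos0.
have hit0 : \sum_(la <- boxed N M | diagram_hit pos0 la) box_weight q xi la =
    \sum_(la <- boxed N M) box_weight q xi la.
  by apply: eq_bigl => la; apply/forallP => -[].
rewrite hit0 (eq_bigl xpredT) in E; last by move=> f; apply/forallP => -[].
have : 0 < (N`!)%:R * \det (gram window_mx).
  rewrite /gram -sum_det_rowsub; under eq_bigr => f _ do rewrite -expr2.
  rewrite E; apply: mulr_gt0; first by rewrite ltr0n fact_gt0.
  by apply: mulr_gt0 => //; rewrite invr_gt0 window_const_gt0.
rewrite pmulr_rgt0 ?ltr0n ?fact_gt0// => detG.
by rewrite unitmxE unitfE lt0r_neq0.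
Qed.

(** Correlations under the weight restricted to a rectangle: a determinantal
    point process whose kernel is an orthogonal projection. *)
Lemma window_correlation n (pos : 'I_n -> 'I_(N + M) + bool) :
  (forall i j u, pos i = inl u -> pos j = inl u -> i = j) ->
  \sum_(la <- boxed N M | diagram_hit pos la) box_weight q xi la =
  (\sum_(la <- boxed N M) box_weight q xi la) * \det (marked_kernel window_mx pos).
Proof.
move=> pos_inj.
have E := sum_window_minors pos; rewrite sum_marked_minors ?window_gram_unit// in E.
pose pos0 : 'I_0 -> 'I_(N + M) + bool := fun=> inr true.
have E0 := sum_window_minors pos0; rewrite sum_marked_minors ?window_gram_unit// det_mx00 mulr1 in E0.
have hit0 : \sum_(la <- boxed N M | diagram_hit pos0 la) box_weight q xi la =
    \sum_(la <- boxed N M) box_weight q xi la.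
  by apply: eq_bigl => la; apply/forallP => -[].
rewrite hit0 in E0.
have f0 : (N`!)%:R != 0 :> R by rewrite pnatr_eq0 -lt0n fact_gt0.
have w0 := lt0r_neq0 window_const_gt0.
apply: (mulfI f0); apply: (mulfI (invr_neq0 w0)).
rewrite mulrCA -E E0; ring.
Qed.

End WindowWeight.

(** * The negative binomial series *)

Section BinomialSeries.
Import numFieldNormedType.Exports.
Local Open Scope classical_set_scope.
Variable R : realType.

Definition negbin_coef (t : R) (n : nat) : R := (\prod_(j < n) (t + j%:R)) / (n`!)%:R.

Lemma negbin_coef_ge0 t n : 0 <= t -> 0 <= negbin_coef t n.
Proof.
move=> t0; apply: divr_ge0 => //; apply: prodr_ge0 => j _.
by rewrite addr_ge0.
Qed.

Let fact_neq0 n : (n`!)%:R != 0 :> R.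
Proof. by rewrite pnatr_eq0 -lt0n fact_gt0. Qed.

Lemma negbin_coef0 t : negbin_coef t 0 = 1.
Proof. by rewrite /negbin_coef big_ord0 fact0 divr1. Qed.

Lemma negbin_coefS t n : n.+1%:R * negbin_coef t n.+1 = t * negbin_coef (t + 1) n.
Proof.
rewrite /negbin_coef big_ord_recl /= addr0 factS natrM.
have -> : \prod_(i < n) (t + (bump 0 i)%:R) = \prod_(i < n) (t + 1 + i%:R).
  by apply: eq_bigr => i _; rewrite /bump /= natrD addrA.
have n0 : n.+1%:R != 0 :> R by rewrite pnatr_eq0.
by have := fact_neq0 n; move: (_`!%:R) (_.+1%:R) n0 => f m m0 f0; field; rewrite f0 m0.
Qed.

(** Pascal's rule: dividing the series by [1 - x] raises [t] by one. *)
Lemma negbin_coef_pascal t n :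
  negbin_coef (t + 1) n.+1 = negbin_coef (t + 1) n + negbin_coef t n.+1.
Proof.
have n0 : n.+1%:R != 0 :> R by rewrite pnatr_eq0.
apply: (mulfI n0); rewrite mulrDr [_ * negbin_coef t _]negbin_coefS -mulrDl [_ + t]addrC.
have -> : t + n.+1%:R = (t + 1) + n%:R by rewrite -natr1; ring.
rewrite /negbin_coef big_ord_recr /= factS natrM.
by have := fact_neq0 n; move: (_`!%:R) (_.+1%:R) n0 => f m m0 f0; field; rewrite f0 m0.
Qed.

Let psum (t x : R) n : R := \sum_(0 <= i < n) negbin_coef t i * x ^+ i.

Let psum_pascal t x n : (1 - x) * psum (t + 1) x n.+1 =
  psum t x n.+1 - x * (negbin_coef (t + 1) n * x ^+ n).
Proof.
rewrite /psum; elim: n => [|n IH].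
  by rewrite !big_nat1 !negbin_coef0 expr0; ring.
rewrite big_nat_recr //= mulrDr IH [in RHS]big_nat_recr //= negbin_coef_pascal exprS.
by ring.
Qed.

(* For [t <= 1] the coefficients are at most 1; Pascal's rule then raises [t] by
   one at the cost of a factor [(1 - x)^-1]. *)
Let psum_bounded t x : 0 <= t -> 0 <= x < 1 -> exists B, forall n, psum t x n <= B.
Proof.
move=> t0 /andP[x0 x1].
have x1' : 0 < 1 - x by rewrite subr_gt0.
suff H m : forall t, 0 <= t -> t <= m.+1%:R -> exists B, forall n, psum t x n <= B.
  apply: (H (Num.truncn t)) => //; apply: ltW.
  by have /andP[] := truncn_itv t0.
elim: m {t t0} => [|m IH] t t0 tm.
  exists (1 - x)^-1 => n.
  have le1 i : negbin_coef t i <= 1.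
    rewrite ler_pdivrMr ?mul1r ?ltr0n ?fact_gt0//.
    elim: i => [|i IHi]; first by rewrite big_ord0 fact0.
    rewrite big_ord_recr /= factS natrM mulrC ler_pM// ?addr_ge0//.
      by apply: prodr_ge0 => j _; rewrite addr_ge0.
    by rewrite -natr1 addrC lerD2l.
  rewrite -[leRHS]mul1r ler_pdivlMr// mulrC.
  apply: (@le_trans _ _ ((1 - x) * \sum_(0 <= i < n) x ^+ i)).
    rewrite ler_wpM2l ?(ltW x1')//; apply: ler_sum => i _.
    by rewrite ler_piMl ?exprn_ge0.
  by rewrite big_mkord -opprB mulNr -subrX1 opprB gerBl exprn_ge0.
have [t1|t1] := leP t 1.
  apply: (IH t) => //; rewrite (le_trans t1)// ler1n//.
have t1' : 0 <= t - 1 by rewrite subr_ge0 ltW.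
have [|B HB] := IH (t - 1) t1'; first by rewrite lerBlDr natr1.
exists (B / (1 - x)) => n; rewrite ler_pdivlMr// mulrC.
case: n => [|n].
  by rewrite /psum big_geq// mulr0; have := HB 0%N; rewrite /psum big_geq.
rewrite -[X in psum X](subrK 1) psum_pascal (le_trans _ (HB n.+1))// gerBl.
by rewrite mulr_ge0// mulr_ge0 ?exprn_ge0// negbin_coef_ge0// subrK.
Qed.

Lemma is_cvg_negbin (t x : R) : 0 <= t -> `|x| < 1 -> cvgn (pseries (negbin_coef t) x).
Proof.
move=> t0 x1; pose K := (`|x| + 1) / 2.
have K1 : `|x| < K /\ K < 1 by rewrite /K; split; lra.
have K0 : 0 < K by apply: le_lt_trans (normr_ge0 x) _; exact: K1.1.
apply: (@is_cvg_pseries_inside _ _ K); last by rewrite [ltRHS]gtr0_norm//; exact: K1.1.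
have [|B HB] := @psum_bounded t K t0; first by rewrite (ltW K0) K1.2.
apply: nondecreasing_is_cvgn.
  apply/nondecreasing_seqP => n; rewrite /pseries /series /= big_nat_recr//= lerDl.
  by rewrite mulr_ge0 ?negbin_coef_ge0// exprn_ge0// ltW.
by exists B => _ [n _ <-]; exact: HB.
Qed.

Definition negbin_fun (t x : R) : R := limn (pseries (negbin_coef t) x).

Lemma negbin_fun_pascal (t x : R) : 0 <= t -> `|x| < 1 ->
  (1 - x) * negbin_fun (t + 1) x = negbin_fun t x.
Proof.
move=> t0 x1; have t10 : 0 <= t + 1 by rewrite addr_ge0.
have C1 := is_cvg_negbin t10 x1; have C0 := is_cvg_negbin t0 x1.
have z : (fun n => x * (negbin_coef (t + 1) n * x ^+ n)) @ \oo --> (0 : R).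
  suff : (fun n => x * (negbin_coef (t + 1) n * x ^+ n)) @ \oo --> x * 0 by rewrite mulr0.
  apply: cvgMr.
  exact: (cvg_series_cvg_0 C1).
apply: (@cvg_unique _ (@Rhausdorff R) ((fun n => (1 - x) * psum (t + 1) x n.+1) @ \oo)).
  apply: cvgMr; rewrite (cvg_shiftS (psum (t + 1) x)); exact: C1.
have -> : (fun n => (1 - x) * psum (t + 1) x n.+1) =
    (fun n => psum t x n.+1 - x * (negbin_coef (t + 1) n * x ^+ n)).
  by apply/funext => n; exact: psum_pascal.
suff : (fun n => psum t x n.+1 - x * (negbin_coef (t + 1) n * x ^+ n)) @ \oo -->
    negbin_fun t x - 0 by rewrite subr0.
apply: cvgB => //.
by rewrite (cvg_shiftS (psum t x)); exact: C0.
Qed.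

Lemma is_derive_negbin (t x : R) : 0 <= t -> `|x| < 1 ->
  is_derive x 1 (negbin_fun t) (t * negbin_fun (t + 1) x).
Proof.
move=> t0 x1; pose K := (`|x| + 1) / 2.
have K1 : `|x| < K /\ K < 1 by rewrite /K; split; lra.
have K0 : 0 < K by apply: le_lt_trans (normr_ge0 x) _; exact: K1.1.
have nK : `|K| < 1 by rewrite gtr0_norm//; exact: K1.2.
have dE s : pseries_diffs (negbin_coef s) = s *: negbin_coef (s + 1).
  by apply/funext => n; rewrite /pseries_diffs negbin_coefS.
have pZ s (c : nat -> R) y : pseries (s *: c) y = s *: pseries c y.
  by rewrite /pseries -seriesZ; congr series; apply/funext => n; rewrite /= -mulrA.
have CZ s u y : 0 <= u -> `|y| < 1 -> cvgn (pseries (s *: negbin_coef u) y).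
  by move=> u0 y1; rewrite pZ; apply: is_cvgZr; exact: is_cvg_negbin.
have t10 : 0 <= t + 1 by rewrite addr_ge0.
have := @pseries_snd_diffs R (negbin_coef t) K x.
rewrite dE => D.
have -> : t * negbin_fun (t + 1) x = limn (pseries (t *: negbin_coef (t + 1)) x).
  by rewrite pZ limZr//; exact: is_cvg_negbin.
apply: D; [exact: is_cvg_negbin | exact: CZ | | by rewrite [ltRHS]gtr0_norm//; exact: K1.1].
have -> : pseries_diffs (t *: negbin_coef (t + 1)) = (t * (t + 1)) *: negbin_coef (t + 1 + 1).
  by rewrite -scalerA -(dE (t + 1)); apply/funext => n; exact: mulrCA.
by apply: CZ => //; rewrite addr_ge0.
Qed.

(** The derivative of the product below vanishes, by [is_derive_negbin] and
    [negbin_fun_pascal]. *)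
Lemma negbin_funE (t x : R) : 0 <= t -> 0 < x < 1 ->
  expR (t * ln (1 - x)) * negbin_fun t x = 1.
Proof.
move=> t0 /andP[x0 x1].
pose g (y : R) : R := expR (t * ln (1 - y)) * negbin_fun t y.
have dg (y : R) : `|y| < 1 -> is_derive y 1 g 0.
  move=> y1; have y1' : 0 < 1 - y by rewrite subr_gt0; apply: le_lt_trans y1; exact: ler_norm.
  have D1 : is_derive y 1 (fun y : R => 1 - y) (-1).
    by apply: is_derive_eq; rewrite add0r mul1r.
  have D2 := @is_derive1_comp R (@ln R) _ y _ _ (is_derive1_ln y1') D1.
  have D3 := @is_derive1_comp R (@expR R) _ y _ _ (is_derive_expR _) (is_deriveZ t D2).
  apply: is_derive_eq (is_deriveM D3 (is_derive_negbin t0 y1)) _.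
  rewrite -(negbin_fun_pascal t0 y1); move: (negbin_fun _ _) => F.
  set E := expR (_ y); change (E * (t * F) + (1 - y) * F * (E * (t * ((1 - y)^-1 * -1))) = 0).
  by field; rewrite lt0r_neq0.
have in01 (y : R) : 0 <= y <= x -> `|y| < 1.
  by move=> /andP[y0 yx]; rewrite ger0_norm// (le_lt_trans yx).
have [|||c _] := @MVT R g (fun=> 0) 0 x.
- exact: x0.
- move=> y; rewrite in_itv /= => /andP[y0 yx].
  by apply: dg; rewrite in01// !ltW.
- apply: derivable_within_continuous => y; rewrite in_itv /= => yx.
  by have [] := dg y (in01 y yx).
rewrite mul0r => /eqP; rewrite subr_eq0 => /eqP gE.
rewrite -[LHS]/(g x) gE /g subr0 ln1 mulr0 expR0 mul1r; apply: cvg_lim => //.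
rewrite -(cvg_shiftS (pseries _ _)) (_ : (fun n => _) = fun=> 1); first exact: cvg_cst.
apply/funext => n; rewrite /pseries /series /= big_nat_recl//= negbin_coef0 expr0 mulr1.
by rewrite big1 ?addr0// => i _; rewrite expr0n mulr0.
Qed.

End BinomialSeries.

(** * A discrete measure on partitions *)

Section DiscreteMeasure.
Import numFieldNormedType.Exports.
Local Open Scope classical_set_scope.
Variables (R : realType) (w : young -> R).
Hypothesis w_ge0 : forall la, 0 <= w la.

Definition level_measure (n : nat) : {measure set young -> \bar R} :=
  msum (fun i => mscale (NngNum (w_ge0 (nth young_empty (level n) i)))
                        (dirac (nth young_empty (level n) i)))
       (size (level n)).

Definition weight_measure : {measure set young -> \bar R} := mseries level_measure 0.

Lemma level_measureE n (A : set young) :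
  level_measure n A = (\sum_(la <- level n) w la * (la \in A)%:R)%:E.
Proof.
rewrite /level_measure /= /msum (big_nth young_empty) big_mkord -sumEFin.
by apply: eq_bigr => i _; rewrite /mscale /=.
Qed.

Lemma weight_measureT (a : nat -> R) : (forall n, \sum_(la <- level n) w la = a n) ->
  series a @ \oo --> (1 : R) -> weight_measure [set: young] = 1%E.
Proof.
move=> aE a1; rewrite /weight_measure /= /mseries.
apply: cvg_lim => //; rewrite (_ : (fun n => _) = EFin \o series a).
  by apply/fine_cvgP; split=> //; exact: nearW.
apply/funext => n; rewrite /= /series /= -sumEFin; apply: eq_bigr => i _.
rewrite level_measureE -aE; congr EFin; apply: eq_bigr => la _.
by rewrite in_setT mulr1.
Qed.

Lemma weight_measure1 la : weight_measure [set la] = (w la)%:E.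
Proof.
rewrite /weight_measure /= /mseries; apply: lim_near_cst => //.
exists (ysize la).+1 => // n /= lan.
rewrite (bigD1_seq (ysize la)) ?mem_index_iota ?iota_uniq//= big1_seq ?adde0.
  rewrite level_measureE (bigD1_seq la) ?level_uniq ?mem_level//=.
  rewrite mem_set// mulr1 big1 ?addr0// => mu mula.
  by rewrite memNset ?mulr0// => /= e; rewrite e eqxx in mula.
move=> m /andP[ml _]; rewrite level_measureE big1_seq// => mu /=.
rewrite mem_level => /eqP mm; rewrite memNset ?mulr0// => /= e.
by rewrite -mm e eqxx in ml.
Qed.

Lemma weight_measure_finite (s : seq young) (E : set young) : uniq s ->
  weight_measure ([set` s] `&` E) = (\sum_(la <- s | la \in E) w la)%:E.
Proof.
elim: s => [_|la s IH /andP[las us]].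
  by rewrite big_nil set_nil set0I measure0.
rewrite big_cons; case: ifP => laE.
  have -> : [set` la :: s] `&` E = [set la] `|` ([set` s] `&` E).
    apply/seteqP; split=> mu /=; rewrite inE.
      by move=> [/orP[/eqP ->|mus] muE]; [left|right].
    by move=> [->|[mus muE]]; rewrite ?eqxx ?mus ?orbT; split=> //; rewrite -in_setE.
  rewrite measureU//.
    by rewrite EFinD -IH//; congr (_ + _)%E; exact: weight_measure1.
  by apply/seteqP; split=> mu //= [-> [las' _]]; rewrite las' in las.
rewrite -IH//; congr (weight_measure _); apply/seteqP; split=> mu /=; rewrite inE.
  move=> [/orP[/eqP mla|mus] muE]; last by [].
  by move: laE; rewrite -mla mem_set.
by move=> [mus muE]; rewrite mus orbT.
Qed.

End DiscreteMeasure.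
(** * Passing to the limit *)

Section Limits.
Import numFieldNormedType.Exports.
Local Open Scope classical_set_scope.
Variable R : realType.

Lemma ultra_cvg_segment (T : Type) (U : set_system T) (f : T -> R) (a b : R) :
  UltraFilter U -> (forall k, a <= f k <= b) -> exists l : R, f @ U --> l.
Proof.
move=> ultraU fab.
have [|l [_ cl]] := @segment_compact R a b (f @ U) _.
  by apply: (@filterS _ U _ setT) filterT => k _; rewrite /= in_itv; exact: fab.
exists l => B nB; have [//|UB] := in_ultra_setVsetC (f @^-1` B) ultraU.
by have [y [yB yB']] := cl (~` B) B UB nB.
Qed.

Lemma cvg_det (T : Type) (F : set_system T) (n : nat)
    (A : T -> 'M[R]_n) (B : 'M[R]_n) : Filter F ->
  (forall i j, (fun k => A k i j) @ F --> B i j) -> (fun k => \det (A k)) @ F --> \det B.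
Proof.
move=> filterF AB; rewrite /determinant.
apply: cvg_big => [|s _]; first exact: add_continuous.
by apply: cvgMr; apply: cvg_big => [|i _]; [exact: mul_continuous|exact: AB].
Qed.

(** Kernels with entries in a compact set converge along an ultrafilter, and so do
    all determinants formed from them. *)
Lemma det_kernel_limit (X : Type) (Kk : nat -> X -> X -> R) :
  (forall k x y, `|Kk k x y| <= 1) ->
  exists K : X -> X -> R, forall n (x : 'I_n -> X) (a b : nat -> R) (l : R),
    a @ \oo --> l -> b @ \oo --> (1 : R) ->
    (forall k, a k = b k * \det (\matrix_(i, j) Kk k (x i) (x j))) ->
    l = \det (\matrix_(i, j) K (x i) (x j)).
Proof.
move=> K1; have [U [ultraU finerU]] := @ultraFilterLemma nat \oo _.
have ex x y : exists l : R, (fun k => Kk k x y) @ U --> l.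
  by apply: (@ultra_cvg_segment _ _ _ (-1) 1 ultraU) => k; rewrite -ler_norml.
have [K KP] : {K : X -> X -> R & forall x y, (fun k => Kk k x y) @ U --> K x y}.
  exists (fun x y => projT1 (cid (ex x y))) => x y; exact: projT2 (cid (ex x y)).
exists K => n x a b l al b1 abE.
have toU (u : nat -> R) (v : R) : u @ \oo --> v -> u @ U --> v.
  by move=> uv B nB; apply: finerU; exact: uv.
apply: (@cvg_unique _ (@Rhausdorff R) (a @ U)); first exact: toU.
have -> : a = (fun k => b k * \det (\matrix_(i, j) Kk k (x i) (x j))) by apply/funext.
suff : (fun k => b k * \det (\matrix_(i, j) Kk k (x i) (x j))) @ U -->
    1 * \det (\matrix_(i, j) K (x i) (x j)) by rewrite mul1r.
apply: cvgM; first exact: toU.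
apply: cvg_det => i j; rewrite mxE.
have -> : (fun k => (\matrix_(i, j) Kk k (x i) (x j)) i j) = (fun k => Kk k (x i) (x j)).
  by apply/funext => k; rewrite mxE.
exact: KP.
Qed.

Definition small_diagrams (k : nat) : seq young :=
  undup (flatten [seq level n | n <- iota 0 k.+1]).

Lemma mem_small_diagrams k la : (la \in small_diagrams k) = (ysize la <= k)%N.
Proof.
rewrite mem_undup; apply/flatten_mapP/idP => [[n]|lak].
  by rewrite mem_iota add0n ltnS mem_level => nk /eqP ->.
by exists (ysize la); rewrite ?mem_level// mem_iota add0n ltnS.
Qed.

(** An exhaustion that contains every diagram of size at most [k] and positive
    weight computes the measure, even if it is not monotone in [k]. *)
Lemma weight_measure_exhaust (w : young -> R) (w_ge0 : forall la, 0 <= w la)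
    (b : nat -> seq young) (E : set young) :
  (forall k, uniq (b k)) ->
  (forall k la, (ysize la <= k)%N -> w la != 0 -> la \in b k) ->
  (fun k => weight_measure w_ge0 ([set` b k] `&` E)) @ \oo --> weight_measure w_ge0 E.
Proof.
move=> ub bk; set mu := weight_measure w_ge0.
have lim : (fun k => mu ([set` small_diagrams k] `&` E)) @ \oo --> mu E.
  have {2}-> : E = \bigcup_k ([set` small_diagrams k] `&` E).
    apply/seteqP; split=> [la laE|la [k _ []]//].
    by exists (ysize la) => //; split=> //=; rewrite mem_small_diagrams.
  apply: nondecreasing_cvg_mu => // m n mn; apply/subsetPset => la /= [lam laE].
  by split=> //; move: lam; rewrite !mem_small_diagrams => /leq_trans; apply.
apply: (squeeze_cvge _ lim (cvg_cst _)); apply: nearW => k.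
apply/andP; split; last first.
  by apply: le_measure; [exact: mem_set|exact: mem_set|exact: subIsetr].
pose Z := [set la | w la = 0].
have Z0 : mu ([set` small_diagrams k] `&` Z) = 0%E.
  rewrite weight_measure_finite ?undup_uniq// big1// => la; rewrite in_setE.
  by [].
apply: (@le_trans _ _ (mu (([set` b k] `&` E) `|` ([set` small_diagrams k] `&` Z)))).
  apply: le_measure; [exact: mem_set|exact: mem_set|move=> la /= [lak laE]].
  have [w0|w0] := eqVneq (w la) 0; first by right.
  by left; split=> //; apply: bk => //; rewrite -mem_small_diagrams.
apply: (le_trans (measureU2 _ _ _)) => //; rewrite -[leRHS]adde0; apply: leeD => //.
by rewrite le_eqVlt; apply/orP; left; apply/eqP; exact: Z0.
Qed.

End Limits.

(** * Maya diagrams in a window *)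

Definition half_floor (x : halfint) : int := Num.floor (val x - 2^-1).

Lemma half_floorE (x : halfint) : val x = (half_floor x)%:~R + 2^-1.
Proof. by have := valP x; rewrite intrEfloor => /eqP; rewrite /half_floor => ->; rewrite subrK. Qed.

Lemma half_floor_inj : injective half_floor.
Proof. by move=> x y e; apply: val_inj; rewrite half_floorE e -half_floorE. Qed.

Lemma mayaE (la : young) (x : halfint) :
  maya la x <-> exists i : nat, half_floor x = (part la i)%:Z - (i.+1)%:Z.
Proof.
have E i : (val x = (part la i)%:R - i%:R - 2^-1) <->
    half_floor x = (part la i)%:Z - (i.+1)%:Z.
  rewrite half_floorE; split=> [e|->].
    apply: (@intr_inj rat); rewrite intrB -[X in _ = _ - X]/((i.+1)%:R) -natr1.
    by rewrite -[X in _ = X - _]/((part la i)%:R); lra.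
  rewrite intrB -[X in _ - X + _]/((i.+1)%:R) -natr1 -[X in X - _ + _]/((part la i)%:R).
  by lra.
by split=> -[i /E ?]; exists i.
Qed.

(** The place of [x] in the window of [N + M] sites whose [N] leftmost sites are
    occupied by the empty diagram; everything to the left of the window is
    occupied, everything to its right is empty. *)
Definition site N M (x : halfint) : 'I_(N + M) + bool :=
  match half_floor x + N%:Z with
  | Posz p => if insub p is Some u then inl u else inr false
  | Negz _ => inr true
  end.

Lemma site_inj N M (x y : halfint) u : site N M x = inl u -> site N M y = inl u -> x = y.
Proof.
have siteE z : site N M z = inl u -> half_floor z + N%:Z = u%:Z.
  by rewrite /site; case: (_ + _) => // p; case: insubP => // v _ <- [->].
move=> /siteE ex /siteE ey; apply: half_floor_inj.
by apply: (addIr N%:Z); rewrite ex ey.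
Qed.

Lemma site_hit N M (la : young) (x : halfint) : la \in boxed N M ->
  maya la x <-> (match site N M x with inl u => val u \in positions la N | inr b => b end : bool).
Proof.
move=> lab; have := lab; rewrite mem_boxed => /andP[laN _]; rewrite mayaE /site.
have pos_row (p : nat) : p \in positions la N <->
    exists i : nat, p%:Z - N%:Z = (part la i)%:Z - (i.+1)%:Z.
  split=> [/mapP[k]|[i e]].
    rewrite mem_iota add0n => /andP[_ kN] ->; exists (N.-1 - k)%N; rewrite /shifted; lia.
  have iN : (i < N)%N.
    rewrite ltnNge; apply/negP => Ni; have := leq_trans laN Ni; rewrite -part_eq0 => /eqP i0.
    by move: e; rewrite i0; lia.
  apply/mapP; exists (N.-1 - i)%N; first by rewrite mem_iota; lia.
  rewrite /shifted; have -> : (N.-1 - (N.-1 - i) = i)%N by lia.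
  by lia.
have e : half_floor x = half_floor x + N%:Z - N%:Z by rewrite addrK.
move: (half_floor x + N%:Z) e => p ->; case: p => [p|m]; last first.
  split=> [//|_]; exists (N + m)%N; have /eqP -> : part la (N + m) == 0%N.
    by rewrite part_eq0 (leq_trans laN)// leq_addr.
  by rewrite NegzE; lia.
rewrite -pos_row; case: insubP => [u _ <-//|pNM]; split=> // /mapP[k].
rewrite mem_iota add0n => /andP[_ kN] pE; case/negP: pNM.
by rewrite pE positions_bound.
Qed.

(** * The measure for a real quadratic weight *)

(** Up to any given size, the diagrams of nonzero weight fit in a rectangle on whose
    contents [q] is positive. A zero of [q] at a content limits the number of rows
    or of columns. *)
Definition admissible (R : realFieldType) (q : R -> R) : Prop :=
  forall n, exists N M,
    (forall c : nat, (c.+1 < N + M)%N -> 0 < q (c%:R - (N.-1)%:R)) /\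
    forall la, (ysize la <= n)%N -> content_prod q la != 0 -> la \in boxed N M.

Section QuadraticMeasure.
Import numFieldNormedType.Exports.
Local Open Scope classical_set_scope.
Variables (R : realType) (xi : R) (q : R -> R).
Hypothesis xi01 : 0 < xi < 1.
Hypothesis q_quadratic : exists s, forall c, q c = c ^+ 2 + s * c + q 0.
Hypothesis q0_ge0 : 0 <= q 0.
Hypothesis q_adm : admissible q.

Let C : R := expR (q 0 * ln (1 - xi)).
Let w (la : young) : R := C * box_weight q xi la.

Let xi_gt0 : 0 < xi. Proof. by case/andP: xi01. Qed.

Let w_ge0 la : 0 <= w la.
Proof.
rewrite mulr_ge0 ?expR_ge0//; have [N [M [qpos small]]] := q_adm (ysize la).
have [q0|q0] := eqVneq (content_prod q la) 0; first by rewrite /box_weight q0 mulr0 mul0r.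
by apply: (box_weight_ge0 xi_gt0 qpos); exact: small.
Qed.

Let sum_level n : \sum_(la <- level n) w la = C * (negbin_coef (q 0) n * xi ^+ n).
Proof.
rewrite /negbin_coef -(level_weight q_quadratic) mulr_suml mulr_sumr.
apply: eq_big_seq => la; rewrite mem_level => /eqP lan.
by rewrite /w /box_weight lan; ring.
Qed.

Let mu := weight_measure w_ge0.

Let muT : mu setT = 1%E.
Proof.
apply: weight_measureT sum_level _; have /andP[_ xi1] := xi01.
rewrite -(negbin_funE q0_ge0 xi01).
have -> : series (fun n => C * (negbin_coef (q 0) n * xi ^+ n)) =
    (fun n => C * pseries (negbin_coef (q 0)) xi n).
  by apply/funext => n; rewrite /pseries /series /= mulr_sumr.
by apply: cvgMr; apply: is_cvg_negbin; rewrite ?gtr0_norm.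
Qed.

(** Restricted to the rectangle provided by [q_adm] for size [k], the measure has
    the correlations of a projection kernel times the mass of the rectangle, and
    this mass tends to 1. *)
Lemma quadratic_measure : exists P : probability young R,
  (forall la, P [set la] = (w la)%:E) /\
  exists K : halfint -> halfint -> R, forall n (x : 'I_n -> halfint), injective x ->
    fine (P [set la | forall i, maya la (x i)]) = \det (\matrix_(i, j) K (x i) (x j)).
Proof.
pose P : probability young R := mnormalize mu (dirac young_empty : probability young R).
have PE A : P A = mu A.
  rewrite /P /= /mnormalize muT /= onee_eq0 /= invr1 mule1.
  by [].
have [N NP] := choice (q_adm : forall n, exists N, _).
have [M NM] := choice NP.
pose ker k := proj_kernel (window_mx q xi (N k) (M k)).
pose Kk k (x y : halfint) : R := match site (N k) (M k) x, site (N k) (M k) y with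
  | inl u, inl v => ker k u v
  | inr b, _ => (b && (x == y))%:R
  | inl _, inr _ => 0
  end.
have gu k := window_gram_unit xi_gt0 (NM k).1.
have [k x y|K KP] := @det_kernel_limit R halfint Kk.
  rewrite /Kk; case sx: (site (N k) (M k) x) => [u|b]; case sy: (site (N k) (M k) y) => [v|b'].
  - by apply: proj_kernel_norm_le1; exact: gu.
  - by rewrite normr0.
  - by case: (b && _); rewrite ?normr1 ?normr0.
  - by case: (b && _); rewrite ?normr1 ?normr0.
exists P; split=> [la|]; first by rewrite PE; exact: weight_measure1.
exists K => n x injx; rewrite PE.
set E := [set la | forall i, maya la (x i)].
pose b k := boxed (N k) (M k).
have exhaust (A : set young) : (fun k => \sum_(la <- b k | la \in A) w la) @ \oo --> fine (mu A).
  have muA : mu A \is a fin_num.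
    rewrite ge0_fin_numE ?measure_ge0//; apply: (@le_lt_trans _ _ (mu setT)).
      by apply: le_measure; [exact: mem_set|exact: mem_set|exact: subsetT].
    by rewrite muT ltry.
  have lim := @weight_measure_exhaust R w w_ge0 b A (fun k => boxed_uniq _ _) _.
  have {}lim : (fun k => mu ([set` b k] `&` A)) @ \oo --> (fine (mu A))%:E.
    rewrite fineK//; apply: lim => k la lak wla; apply: (NM k).2 => //.
    by apply: contraNneq wla => cp0; rewrite /w /box_weight cp0 mulr0 mul0r mulr0.
  apply: cvg_trans (fine_cvg lim); apply: near_eq_cvg; apply: nearW => k /=.
  by rewrite weight_measure_finite ?boxed_uniq.
apply: (KP n x _ _ _ (exhaust E)).
  by have := exhaust setT; rewrite muT; exact.
move=> k; pose pos i := site (N k) (M k) (x i).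
have pos_inj i j u : pos i = inl u -> pos j = inl u -> i = j.
  by move=> pi pj; apply: injx; exact: (@site_inj (N k) (M k) _ _ u).
have WC := window_correlation xi_gt0 (NM k).1 pos_inj.
have mkE : marked_kernel (window_mx q xi (N k) (M k)) pos = \matrix_(i, j) Kk k (x i) (x j).
  by apply/matrixP => i j; rewrite !mxE /Kk /pos (inj_eq injx).
have -> : \sum_(la <- b k | la \in setT) w la = C * \sum_(la <- b k) box_weight q xi la.
  by rewrite mulr_sumr; apply: eq_bigl => la; rewrite in_setT.
rewrite -mulrA -mkE -WC mulr_sumr.
rewrite big_seq_cond [RHS]big_seq_cond; apply: eq_bigl => la.
case lab: (la \in b k) => //=; apply/idP/forallP => [laE i|hit].
  by move: laE; rewrite in_setE => /(_ i); exact: (proj1 (site_hit (x i) lab)).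
by rewrite in_setE => i; exact: (proj2 (site_hit (x i) lab) (hit i)).
Qed.

End QuadraticMeasure.

(** * The three series of parameters *)

Section Admissible.
Variables (R : realFieldType) (q : R -> R).

Lemma part_le_ysize (la : young) i : (part la i <= ysize la)%N.
Proof.
rewrite (ysizeE (leq_maxl (ylength la) i.+1)).
by rewrite (bigD1 (Ordinal (leq_maxr (ylength la) i.+1)))//= leq_addr.
Qed.

Lemma content_prod_eq0 (la : young) i j : (j < part la i)%N -> q (j%:R - i%:R) = 0 ->
  content_prod q la = 0.
Proof.
move=> jla q0; have ila : (i < ylength la)%N.
  by rewrite ltnNge -part_eq0 -lt0n (leq_ltn_trans _ jla).
by rewrite /content_prod (bigD1 (Ordinal ila))//= (bigD1 (Ordinal jla))//= q0 !mul0r.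
Qed.

Lemma admissible_pos : (forall k : int, 0 < q k%:~R) -> admissible q.
Proof.
move=> q0 n; exists n, n; split=> [c _|la lan _].
  by have := q0 (c%:Z - n.-1%:Z); rewrite intrB.
rewrite mem_boxed (leq_trans (ylength_le_ysize la) lan).
by rewrite (leq_trans (part_le_ysize la 0) lan).
Qed.

(** The box [(m, 0)] has content [- m], so only diagrams with at most [m] rows
    carry mass. *)
Lemma admissible_rows (m : nat) (y : R) : (0 < m)%N -> m%:R - 1 < y ->
  (forall c, q c = (c + m%:R) * (c + y)) -> admissible q.
Proof.
case: m => // m _ my qE n; exists m.+1, n; split=> [c _|la lan cp].
  have c0 : 0 <= c%:R :> R by [].
  by rewrite qE /=; move: my; rewrite -natr1 => my; apply: mulr_gt0; lra.
rewrite mem_boxed (leq_trans (part_le_ysize la 0) lan) andbT -part_eq0.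
apply: contraNT cp => pm; apply/eqP; apply: (@content_prod_eq0 _ m.+1 0).
  by rewrite lt0n.
by rewrite qE; ring.
Qed.

(** Symmetrically, the box [(0, m)] has content [m]. *)
Lemma admissible_columns (m : nat) (y : R) : (0 < m)%N -> m%:R - 1 < y ->
  (forall c, q c = (c - m%:R) * (c - y)) -> admissible q.
Proof.
move=> m0 my qE n; exists n, m; split=> [c cnm|la lan cp].
  have : (c + 2 <= n.-1 + m + 1)%N by lia.
  rewrite -(ler_nat R) !natrD => cm.
  by rewrite qE nmulr_rgt0; lra.
rewrite mem_boxed (leq_trans (ylength_le_ysize la) lan) /= leqNgt.
apply: contra cp => pm; apply/eqP; apply: (@content_prod_eq0 _ 0 m) => //.
by rewrite qE; ring.
Qed.

End Admissible.

Local Open Scope classical_set_scope.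
Local Open Scope complex_scope.

Definition has_determinantal_zmeasure (R : realType) (xi : R) (z z' : R[i]) : Prop :=
  exists M : probability young R,
    (forall la : young, (fine (M [set la]))%:C = zweight z z' xi la) /\
    determinantal (distribution M maya).

Section ComplexParameters.
Variables (R : realType) (xi : R) (z z' : R[i]) (s t : R).
Hypothesis xi01 : 0 < xi < 1.
Hypothesis sumE : z + z' = s%:C.
Hypothesis mulE : z * z' = t%:C.
Let q (c : R) : R := c ^+ 2 + s * c + t.

Lemma gen_rising_content_prod la :
  gen_rising z la * gen_rising z' la = (content_prod q la)%:C.
Proof.
rewrite /gen_rising /content_prod rmorph_prod -big_split; apply: eq_bigr => i _.
rewrite /rising /= rmorph_prod -big_split; apply: eq_bigr => j _ /=.
rewrite /q !rmorphD rmorphXn rmorphM rmorphB /= !rmorph_nat -sumE -mulE.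
ring.
Qed.

Lemma zweightE la : zweight z z' xi la =
  (expR (t * ln (1 - xi)) * box_weight q xi la)%:C.
Proof.
rewrite /zweight mulE /cpow /= mul0r cos0 sin0.
rewrite -[_ * gen_rising z' la]mulrA gen_rising_content_prod.
have dimE : ((ydim la)%:R / ((ysize la)`!)%:R) ^+ 2 =
    (((ydim la)%:R / ((ysize la)`!)%:R) ^+ 2)%:C :> R[i].
  by rewrite rmorphXn fmorph_div /= !rmorph_nat.
rewrite dimE -rmorphXn /= -[1 +i* 0]/(1%:C) -!rmorphM /=; congr (_%:C).
by rewrite /box_weight mulr1 !mulrA.
Qed.

Lemma zmeasure_determinantal : 0 <= t -> admissible q ->
  has_determinantal_zmeasure xi z z'.
Proof.
move=> t0 adm; have q0 : q 0 = t by rewrite /q; ring.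
have [|||M [M1 [K KP]]] := @quadratic_measure R xi q xi01.
- by exists s => c; rewrite q0.
- by rewrite q0.
- exact: adm.
exists M; split=> [la|].
  by rewrite M1 /= q0 zweightE.
exists (fun x y => (K x y)%:C) => n x _ injx.
transitivity ((\det (\matrix_(i, j) K (x i) (x j)))%:C).
  by congr (_%:C); rewrite -KP.
rewrite -det_map_mx; congr (\det _).
by apply/matrixP => i j; rewrite !mxE.
Qed.

End ComplexParameters.

Section Series.
Variables (R : realType) (xi : R).
Hypothesis xi01 : 0 < xi < 1.

Lemma principal_series z z' : principal z z' -> has_determinantal_zmeasure xi z z'.
Proof.
move=> [imz [_ ->]]; case: z imz => a b /= /eqP b0.
apply: (@zmeasure_determinantal _ _ _ _ (a + a) (a ^+ 2 + b ^+ 2)) => //.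
- by apply/eqP; rewrite eq_complex /= subrr !eqxx.
- by apply/eqP; rewrite eq_complex /=; apply/andP; split; apply/eqP; ring.
- by rewrite addr_ge0 ?sqr_ge0.
apply: admissible_pos => k.
have -> : k%:~R ^+ 2 + (a + a) * k%:~R + (a ^+ 2 + b ^+ 2) = (k%:~R + a) ^+ 2 + b ^+ 2.
  by ring.
by rewrite ltr_wpDl ?sqr_ge0// lt0r sqrf_eq0 b0 sqr_ge0.
Qed.

Lemma real_parameters (x x' : R) : 0 <= x * x' ->
  admissible (fun c => (c + x) * (c + x')) -> has_determinantal_zmeasure xi x%:C x'%:C.
Proof.
move=> xx0 adm; apply: (@zmeasure_determinantal _ _ _ _ (x + x') (x * x')) => //.
- by rewrite rmorphD.
- by rewrite rmorphM.
rewrite (_ : (fun c => _) = (fun c => (c + x) * (c + x')))//.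
by apply/funext => c; ring.
Qed.

Lemma complementary_series z z' : complementary z z' -> has_determinantal_zmeasure xi z z'.
Proof.
move=> [x [x' [m [-> -> /andP[mx xm] /andP[mx' x'm]]]]].
have pos (k : int) : 0 < (k%:~R + x) * (k%:~R + x').
  have [mk|km] := lerP (- m) k.
    have : - m%:~R <= k%:~R :> R by rewrite -intrN ler_int.
    by move=> ?; apply: mulr_gt0; lra.
  have : k%:~R + 1 <= - m%:~R :> R by rewrite -intrN -[1]/(1%:~R) -intrD ler_int; lia.
  by move: xm x'm; rewrite intrD => *; rewrite nmulr_rgt0; lra.
apply: real_parameters; last exact: admissible_pos pos.
by have := pos 0; rewrite !add0r; apply: ltW.
Qed.

Lemma degenerate_at_series z z' : degenerate_at z z' -> has_determinantal_zmeasure xi z z'.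
Proof.
move=> [m [y [-> -> m0 my my1]]]; apply: real_parameters; first exact: ltW.
case: m m0 my my1 => [m|m] m0 my my1.
  have mpos : (0 < m)%N by rewrite lt0n.
  have y0 : 0 < y by move: my; rewrite pmulr_rgt0// ltr0n.
  apply: (@admissible_rows _ _ m y) => //.
  by move: my1; rewrite !gtr0_norm// ltr0n.
have mE : (Negz m)%:~R = - (m.+1)%:R :> R by rewrite NegzE intrN.
rewrite mE in my my1 *.
have y0 : y < 0 by move: my; rewrite nmulr_rgt0// oppr_lt0 ltr0n.
apply: (@admissible_columns _ _ m.+1 (- y)) => //.
  by move: my1; rewrite normrN (ltr0_norm y0) ger0_norm.
by move=> c; rewrite opprK.
Qed.

Lemma zmeasure_sym z z' : has_determinantal_zmeasure xi z z' -> has_determinantal_zmeasure xi z' z.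
Proof.
move=> [M [M1 det]]; exists M; split=> // la; rewrite M1 /zweight.
by rewrite [z' * z]mulrC; congr (_ * _); exact: mulrAC.
Qed.

End Series.

Theorem theorem3p1 (R : realType) (xi : R) (z z' : R[i])
    (hxi : 0 < xi < 1)
    (hz : principal z z' \/ complementary z z' \/ degenerate z z') :
  exists M : probability young R,
    (forall la : young, (fine (M [set la]))%:C = zweight z z' xi la) /\
    determinantal (distribution M maya).
Proof.
case: hz => [hz|[hz|[hz|hz]]].
- exact: (principal_series hxi hz).
- exact: (complementary_series hxi hz).
- exact: (degenerate_at_series hxi hz).
- exact: (zmeasure_sym (degenerate_at_series hxi hz)).
Qed.
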